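(* Let $P\in\mathcal S(\pi)$ be such that $P$ (and hence $\frac12(P+P^* )$) is a compact operator on $L^2(\pi)$. Let $G$ be a locally compact topological group with Haar measure $\mu$ that acts on $\mathcal X$, and assume that $\pi$ is $G$-invariant. Let $\lambda=\lambda(P)$ be the right spectral gap of $P$ and let $\lambda_2=\lambda_2(P)>\lambda$ be the next smallest eigenvalue after $\lambda$ of $-\frac{L+L^*}{2}$, where $L=P-I$ (that is, the smallest eigenvalue strictly larger than $\lambda$, assumed to exist). Let $W$ be the eigenspace of $-\frac{L+L^*}{2}$ for $\lambda$ and $V$ the subspace of $G$-invariant functions in $L^2(\pi)$. Then $$\lambda(\overline P)\ge \min\Big\{\|\mathbf P_V\mathbf P_W\mathbf P_V\|_{2\to2}\,\lambda(P)+\big(1-\|\mathbf P_V\mathbf P_W\mathbf P_V\|_{2\to2}\big)\lambda_2(P),\ \ \|\mathbf P_{V^\perp}\mathbf P_W\mathbf P_{V^\perp}\|_{2\to2}\,\lambda(P)+\big(1-\|\mathbf P_{V^\perp}\mathbf P_W\mathbf P_{V^\perp}\|_{2\to2}\big)\lambda_2(P)\Big\}\ge\lambda(P),$$ and $\lambda(\overline P)>\lambda(P)$ if $W\cap V=W\cap V^\perp=\{0\}$. Specifically, if $W$ is one-dimensional, spanned by $u$ with $\|u\|_\pi=1$, then $$\lambda(\overline P)\ge\min\Big\{\|u_V\|_\pi^2\,\lambda(P)+(1-\|u_V\|_\pi^2)\,\lambda_2(P),\ \ (1-\|u_V\|_\pi^2)\,\lambda(P)+\|u_V\|_\pi^2\,\lambda_2(P)\Big\}\ge\lambda(P),$$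 where $u_V=\mathbb E_{g\sim\mu}[U_g[u]]$. In this case $\lambda(\overline P)>\lambda(P)$ holds as long as $u$ is not $G$-invariant and $u_V\ne0$.
   Context: $\mathcal X$ is a Polish space with its $\sigma$-algebra $\mathcal F$; $\pi$ is a probability measure on $\mathcal X$; a Markov kernel $P$ acts on functions by $P[f](x)=\int f(y)P(x,dy)$. $\mathcal S(\pi)$ is the set of Markov kernels $P$ with $\pi P=\pi$; such $P$ is viewed as a bounded operator on the real Hilbert space $L^2(\pi)$ with inner product $\langle f,h\rangle_\pi=\int fh\,d\pi$, norm $\|\cdot\|_\pi$, and adjoint $P^*$. $L^2_0(\pi)=\{f\in L^2(\pi):\langle f,\mathbf 1\rangle_\pi=0\}$, and $\|T\|_{2\to2}=\sup\{\|T[f]\|_\pi: f\in L_0^2(\pi),\|f\|_\pi=1\}$. $G$ acts measurably on $\mathcal X$; its Haar measure $\mu$ is normalized to be a probability measure, so that $\mathbb E_{g\sim\mu}$ denotes integration against $\mu$. $U_g[f](x)=f(gx)$ for $g\in G$. $\pi$ is $G$-invariant if $\pi(gA)=\pi(A)$ for all $g\in G$, $A\in\mathcal F$. A function $f$ is $G$-invariant if $U_g[f]=f$ for all $g\in G$. $\overline P=\mathbb E_{g\sim\mu}(U_gPU_g^{-1})$. Standing assumption: $\pi$ has a density with respect to a reference measure $\mathfrak m$ on $\mathcal X$, and $\mathfrak m$ is invariant under every $g\in G$. The right spectral gap is $\lambda(P)=\inf\{\langle f,-L[f]\rangle_\pi: f\in L^2_0(\pi),\|f\|_\pi=1\}$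 with $L=P-I$. $V=\{f\in L^2(\pi):U_g[f]=f\ \forall g\in G\}$, $W=\{f\in L^2(\pi):-\frac{L+L^*}{2}[f]=\lambda f\}$. $V^\perp$ is the orthogonal complement of $V$ in $L^2(\pi)$, and $\mathbf P_\Omega$ is the orthogonal projection of $L^2(\pi)$ onto a closed subspace $\Omega$. *)

(* Defs.v *)
From HB Require Import structures.
From mathcomp Require Import all_boot all_order all_algebra.
From mathcomp Require Import all_classical all_reals all_analysis.

Set Implicit Arguments.
Unset Strict Implicit.
Unset Printing Implicit Defensive.

Import Order.TTheory GRing.Theory Num.Theory.
Import numFieldNormedType.Exports.

Local Open Scope classical_set_scope.
Local Open Scope ring_scope.

Notation borel T := (g_sigma_algebraType (@open T)).

(* A Polish space is a separable space with a complete metric; on a complete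
   pseudometric space the Hausdorff axiom says that the pseudometric is a
   metric. *)
Definition polish (R : realType) (X : completePseudoMetricType R) : Prop :=
  hausdorff_space X /\ exists2 D : set X, countable D & dense D.

(* The distinguished point is only there because measurableType requires one. *)
HB.structure Definition PreTopologicalGroup :=
  {G of PointedTopological G & Group G}.

HB.mixin Record PreTopologicalGroup_isTopologicalGroup G
    & PreTopologicalGroup G := {
  mulg_continuous : continuous (fun gh : G * G => (gh.1 * gh.2)%g) ;
  invg_continuous : continuous (fun g : G => g^-1%g) }.

#[short(type="topologicalGroupType")]
HB.structure Definition TopologicalGroup :=
  {G of PreTopologicalGroup G & PreTopologicalGroup_isTopologicalGroup G}.

(* Left Haar measure. Compact sets are required to be measurable because G is
   not assumed to be Hausdorff; in a Hausdorff group this is automatic. *)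
Record haar_measure (R : realType) (G : topologicalGroupType)
    (mu : {measure set (borel G) -> \bar R}) : Prop := HaarMeasure {
  haar_neq0 : mu [set: G] <> 0%E ;
  haar_left_invariant : forall (g : G) (A : set (borel G)), measurable A ->
    mu [set (g * h)%g | h in A] = mu A ;
  haar_compact_fin : forall K : set (borel G), measurable K ->
    compact (K : set G) -> (mu K < +oo)%E ;
  haar_outer_regular : forall A : set (borel G), measurable A ->
    mu A = ereal_inf [set mu U | U in [set U : set (borel G) |
      open (U : set G) /\ A `<=` U]] ;
  haar_inner_regular : forall U : set (borel G), open (U : set G) ->
    mu U = ereal_sup [set mu K | K in [set K : set (borel G) |
      [/\ measurable K, compact (K : set G) & K `<=` U]]] }.

Record measurable_action (G : topologicalGroupType) d (X : measurableType d)
    (act : G -> X -> X) : Prop := MeasurableAction {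
  action_one : forall x, act 1%g x = x ;
  action_mul : forall g h x, act (g * h)%g x = act g (act h x) ;
  action_measurable : measurable_fun [set: borel G * X]
    (fun gx : borel G * X => act gx.1 gx.2) }.

Definition invariant_measure (R : realType) (G : Type) d (X : measurableType d)
    (act : G -> X -> X) (nu : {measure set X -> \bar R}) : Prop :=
  forall (g : G) (A : set X), measurable A -> nu (act g @` A) = nu A.

Definition has_density (R : realType) d (X : measurableType d)
    (nu m : {measure set X -> \bar R}) : Prop :=
  exists rho : X -> R,
    [/\ measurable_fun [set: X] rho, (forall x, 0 <= rho x) &
        forall A, measurable A -> nu A = (\int[m]_(x in A) (rho x)%:E)%E].

Definition stationary (R : realType) d (X : measurableType d)
    (pi : {measure set X -> \bar R}) (P : R.-pker X ~> X) : Prop :=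
  forall A : set X, measurable A -> (\int[pi]_x P x A)%E = pi A.

Definition kernel_op (R : realType) d (X : measurableType d)
    (P : R.-pker X ~> X) (f : X -> R) : X -> R :=
  fun x => \int[P x]_y f y.

(* Elements of L^2(pi) are represented by square-integrable functions, operators
   act on functions, and vectors are equal when they are equal pi-a.e. *)
Section L2.
Context (R : realType) d (X : measurableType d) (pi : probability X R).
Implicit Types (f h : X -> R) (T : (X -> R) -> (X -> R)) (S : set (X -> R)).

Definition L2 : set (X -> R) := [set f | f \in Lfun pi 2%:E].

Definition L2_inner f h : R := \int[pi]_x (f x * h x).

Definition L2_norm f : R := Num.sqrt (L2_inner f f).

Definition L20 : set (X -> R) := L2 `&` [set f | L2_inner f (cst 1) = 0].

Definition L20_opnorm T : R :=
  sup [set L2_norm (T f) | f in L20 `&` [set f | L2_norm f = 1]].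

Definition compact_operator T : Prop :=
  forall f_ : nat -> X -> R, (forall n, L2 (f_ n)) ->
    (exists M : R, forall n, L2_norm (f_ n) <= M) ->
  exists2 k : nat -> nat, {homo k : m n / (m < n)%N} &
  exists2 h, L2 h & L2_norm (T (f_ (k n)) \- h) @[n --> \oo] --> (0 : R).

(* T^* f is a vector with <T k, f> = <k, T^* f> for all k: unique up to
   pi-a.e. equality, it exists when T is bounded. *)
Definition L2_adjoint T f : X -> R :=
  xget (cst 0)
    [set h | L2 h /\ forall k, L2 k -> L2_inner (T k) f = L2_inner k h].

Definition L2_orth S : set (X -> R) :=
  L2 `&` [set f | forall h, S h -> L2_inner f h = 0].

(* The orthogonal projection of f in L^2(pi), for S a closed subspace. *)
Definition L2_proj S f : X -> R :=
  xget (cst 0) [set h | S h /\ L2_orth S (f \- h)].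

Definition trivial_space S : Prop := forall f, S f -> f = cst 0 %[ae pi].

Definition generator T f : X -> R := T f \- f.

Definition right_gap T : R :=
  inf [set L2_inner f (\- generator T f) |
       f in L20 `&` [set f | L2_norm f = 1]].

Definition neg_sym_gen T f : X -> R :=
  fun x => - ((generator T f x + L2_adjoint (generator T) f x) / 2).

Definition L2_eigenspace T (a : R) : set (X -> R) :=
  L2 `&` [set f | T f = (fun x => a * f x) %[ae pi]].

Definition L2_eigenvalue T (a : R) : Prop :=
  exists2 f, L2_eigenspace T a f & ~ (f = cst 0 %[ae pi]).

Definition next_eigenvalue T (a b : R) : Prop :=
  [/\ a < b, L2_eigenvalue T b &
      forall c, L2_eigenvalue T c -> a < c -> b <= c].

End L2.

Section Symmetrization.
Context (R : realType) (G : topologicalGroupType) d (X : measurableType d).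
Context (act : G -> X -> X) (mu : probability (borel G) R).
Implicit Types (f : X -> R) (T : (X -> R) -> (X -> R)).

Definition U_op (g : G) f : X -> R := fun x => f (act g x).

(* U_g^{-1} is U_(g^-1). *)
Definition sym_op T f : X -> R :=
  fun x => \int[mu]_g U_op g (T (U_op g^-1%g f)) x.

Definition avg f : X -> R := fun x => \int[mu]_g U_op g f x.

Definition inv_space (pi : probability X R) : set (X -> R) :=
  L2 pi `&` [set f | forall g, U_op g f = f %[ae pi]].

End Symmetrization.

(* Main.v *)
Require Import Defs.
From mathcomp Require Import all_boot all_order all_algebra.
From mathcomp Require Import all_classical all_reals all_analysis.
From mathcomp Require Import measurable_realfun ring lra.

Set Implicit Arguments.
Unset Strict Implicit.
Unset Printing Implicit Defensive.

Import Order.TTheory GRing.Theory Num.Theory.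
Import numFieldNormedType.Exports.

Local Open Scope classical_set_scope.
Local Open Scope ring_scope.

(* Write S for the self-adjoint part of P on L^2_0(pi), l for the gap and W for
   the l-eigenspace of 1 - S. Compactness makes the spectrum of S discrete away
   from 0, so that <f, S f> <= (1 - l2) |f|^2 + (l2 - l) |P_W f|^2. By the
   invariance of pi, <f, Pbar f> is the average over g of <f_g, S f_g> with
   f_g = U_g^{-1} f. Split f = v + h with v in V and h in V^perp: then
   f_g = v + h_g with h_g in V^perp, the cross terms <P_W v, h_g> average to 0,
   and |P_W v|^2 <= a |v|^2, |P_W h_g|^2 <= b |h|^2.
   For the strict inequality one needs a, b < 1. If l <> 1 the eigenspace W is
   finite-dimensional and this is compactness of its unit ball. If l = 1 then W
   is the kernel of S and may be infinite-dimensional, but its complement in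
   L^2_0 is finite-dimensional because -S >= l2 - 1 there.
   By left invariance of mu, averaging U_g^{-1} over g gives the projection onto
   V; averaging U_g gives its adjoint, hence the same operator. *)

(** * Semi-inner product spaces *)

(** Vectors are functions, not classes modulo pi-a.e. equality, so the abstract theory uses a
    possibly degenerate form: equality becomes vanishing of the norm of the difference, and
    operators are linear only up to null vectors. For [kernel_op] the latter is forced, since the
    integral against P x takes a default value at the points x where f is not integrable. The
    obstacle in bounding S off W is the value 0. The supremum of <S x, x> over the unit sphere of a
    stable subspace is an eigenvalue if it is nonzero; if it is 0, compactness does not make it
    attained. This has to be excluded when l2 > 1. With e = l2 - 1, the operator -e S - S^2 is
    positive only where the spectrum of S meets ]-e, 0[, and a positive supremum of its form is
    attained. A second mismatch is that the eigenvalues are those on L^2(pi) while the gap lives on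
    L^2_0(pi). An eigenvector for a nonzero eigenvalue of 1 - S has mean zero; if l = 0 then W
    contains the constants, and projecting on W still preserves mean zero. *)

Section RealSequences.
Context (R : realType).
Implicit Types (u : nat -> R) (k : nat -> nat).

(** The minimum over t is at b / c. The case c = 0 has to be covered, because it occurs at null
    vectors of a degenerate form. *)
Lemma discriminant_le (a b c : R) : 0 <= c ->
  (forall t, 0 <= a - 2 * t * b + t ^+ 2 * c) -> b ^+ 2 <= a * c.
Proof.
move=> c0 h; have [cp|cn] := ltP 0 c.
  have := h (b / c); have -> : a - 2 * (b / c) * b + (b / c) ^+ 2 * c =
    (a * c - b ^+ 2) / c by field; rewrite gt_eqF.
  by rewrite pmulr_lge0 ?invr_gt0// subr_ge0.
have ->: c = 0 by apply/eqP; rewrite eq_le c0 cn.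
have [->|b0] := eqVneq b 0; first by rewrite mulr0 expr0n.
(* With c = 0 the expression is affine in t, and this t gives it the value -1. *)
have := h ((a + 1) / (2 * b)).
have -> : a - 2 * ((a + 1) / (2 * b)) * b + ((a + 1) / (2 * b))
  ^+ 2 * c = -1 + ((a + 1) / (2 * b)) ^+ 2 * c.
  by field.
have ->: c = 0 by apply/eqP; rewrite eq_le c0 cn.
by lra.
Qed.

Lemma cvg_sqr0 u : u n ^+ 2 @[n --> \oo] --> (0 : R) ->
  u n @[n --> \oo] --> (0 : R).
Proof.
move=> h; apply/norm_cvg0P.
rewrite (_ : (fun n => `|u n|) = (fun n => Num.sqrt (u n ^+ 2))); last first.
  by apply/funext => n; rewrite sqrtr_sqr.
by rewrite -(sqrtr0 R); exact: continuous_cvg (@sqrt_continuous R 0) h.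
Qed.

Lemma cvg0_le_const u (c : R) :
  (forall n, 0 <= u n <= c / n.+1%:R) -> u n @[n --> \oo] --> (0 : R).
Proof.
move=> h; apply: (@squeeze_cvgr _ _ _ _ (cst 0) (fun n => c * n.+1%:R^-1)).
- by near=> n; exact: h.
- exact: cvg_cst.
- by rewrite -[X in _ --> X](mulr0 c); apply: cvgM;
    [exact: cvg_cst|exact: cvg_harmonic].
Unshelve. all: end_near. Qed.

Lemma homo_cvgy k : {homo k : m n / (m < n)%N} -> k n @[n --> \oo] --> \oo.
Proof.
move=> hk; have kn n : (n <= k n)%N.
  by elim: n => // n ih; apply: leq_ltn_trans ih _; exact: hk.
apply/cvgnyPge => A; near=> n; apply: leq_trans (kn n); near: n.
exact: nbhs_infty_ge.
Unshelve. all: end_near. Qed.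

End RealSequences.

Section SemiHilbert.
Context (R : realType) (E : lmodType R) (ip : E -> E -> R).
Implicit Types (x y z : E) (u v : nat -> E) (H K M : set E) (S T : E -> E).

Local Notation q x := (ip x x).

Definition converges u x := q (u n - x) @[n --> \oo] --> (0 : R).

(** Definiteness is left out, so limits are determined only up to null vectors; square-integrable
    functions then form an instance without a quotient. *)
Record semi_hilbert : Prop := SemiHilbert {
  ipC : forall x y, ip x y = ip y x ;
  ipDl : forall x y z, ip (x + y) z = ip x z + ip y z ;
  ipZl : forall a x z, ip (a *: x) z = a * ip x z ;
  ip_ge0 : forall x, 0 <= q x ;
  ip_complete : forall u, (forall e, 0 < e -> exists N, forall m n,
      (N <= m)%N -> (N <= n)%N -> q (u m - u n) < e) ->
    exists x, converges u x }.

Record subspace H : Prop := Subspace {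
  subspace0 : H 0 ;
  subspaceP : forall a x y, H x -> H y -> H (a *: x + y) }.

(** A constant sequence converges to every vector at distance zero, so such a set is also stable
    under null perturbations. *)
Definition closed_in H := forall u x, (forall n, H (u n)) -> converges u x -> H x.

Record closed_subspace H : Prop := ClosedSubspace {
  csub_sub :> subspace H ;
  csub_closed : closed_in H }.

(** Linearity is no field: symmetry implies it up to null vectors ([sym_linq]), and a kernel
    operator on functions may fail it exactly. *)
Record symmetric_on H S : Prop := SymmetricOn {
  sym_stable : forall x, H x -> H (S x) ;
  sym_ip : forall x y, H x -> H y -> ip (S x) y = ip x (S y) ;
  sym_bounded : exists C, forall x, H x -> q (S x) <= C * q x }.

Definition compact_on H S := forall u, (forall n, H (u n)) ->
  (exists B : R, forall n, q (u n) <= B) ->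
  exists2 k, {homo k : m n / (m < n)%N} & exists y, converges (S \o u \o k) y.

Definition orth M : set E := [set x | forall y, M y -> ip x y = 0].

Definition eigen_on H S c : set E := [set x | H x /\ q (S x - c *: x) = 0].

Hypothesis hE : semi_hilbert.

Lemma ipDr x y z : ip z (x + y) = ip z x + ip z y.
Proof. by rewrite ipC// ipDl// ipC// (ipC hE y). Qed.
Lemma ipZr a x z : ip z (a *: x) = a * ip z x.
Proof. by rewrite ipC// ipZl// ipC. Qed.
Lemma ipNl x z : ip (- x) z = - ip x z.
Proof. by rewrite -scaleN1r ipZl// mulN1r. Qed.
Lemma ipNr x z : ip z (- x) = - ip z x.
Proof. by rewrite ipC// ipNl ipC. Qed.
Lemma ip0l z : ip 0 z = 0.
Proof. by rewrite -(scale0r z) ipZl// mul0r. Qed.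
Lemma ip0r z : ip z 0 = 0.
Proof. by rewrite ipC// ip0l. Qed.

Definition ipE := (ipDl hE, ipDr, ipZl hE, ipZr, ipNl, ipNr, ip0l, ip0r).

Lemma cauchy_schwarz x y : ip x y ^+ 2 <= q x * q y.
Proof.
apply: discriminant_le => [|t]; first exact: ip_ge0.
have := ip_ge0 hE (x - t *: y); rewrite !ipE (ipC hE y x).
by congr (_ <= _); ring.
Qed.

Lemma null_ip y x : q x = 0 -> ip x y = 0.
Proof.
move=> qx; have := cauchy_schwarz x y; rewrite qx mul0r => h.
by apply/eqP; rewrite -sqrf_eq0; apply/eqP/le_anti; rewrite h sqr_ge0.
Qed.

Lemma null_eq z x y : q (x - y) = 0 -> ip x z = ip y z.
Proof. by move=> /(null_ip z)/eqP; rewrite !ipE subr_eq0 => /eqP. Qed.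

Lemma null_q x y : q (x - y) = 0 -> q x = q y.
Proof. by move=> h; rewrite (null_eq _ h) ipC// (null_eq _ h). Qed.

Lemma null_sub x y z : q (x - y) = 0 -> q (x - z) = q (y - z).
Proof. by move=> h; apply: null_q; rewrite opprB addrA subrK. Qed.

Lemma q_add x y : q (x + y) <= 2 * q x + 2 * q y.
Proof.
have := ip_ge0 hE (x - y); rewrite !ipE (ipC hE y x); lra.
Qed.

Lemma qB x y : q (x - y) = q (y - x).
Proof. by rewrite !ipE; ring. Qed.

Lemma cv_q0 u v x y (c : R) : (forall n, q (v n - y) <= c * q (u n - x)) ->
  converges u x -> converges v y.
Proof.
move=> h hx; apply: (@squeeze_cvgr _ _ _ _ (cst 0) (fun n => c * q (u n - x))).
- by near=> n; rewrite ip_ge0//= h.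
- exact: cvg_cst.
- by rewrite -[X in _ --> X](mulr0 c); apply: cvgM; [exact: cvg_cst|].
Unshelve. all: end_near. Qed.

Lemma cv_ip u x y : converges u x -> ip (u n) y @[n --> \oo] --> ip x y.
Proof.
move=> hx; apply/subr_cvg0/cvg_sqr0.
apply: (@squeeze_cvgr _ _ _ _ (cst 0) (fun n => q (u n - x) * q y)).
- near=> n; rewrite sqr_ge0/=; have := cauchy_schwarz (u n - x) y.
  by rewrite ipDl// ipNl.
- exact: cvg_cst.
- by rewrite -[X in _ --> X](mul0r (q y)); apply: cvgM; [|exact: cvg_cst].
Unshelve. all: end_near. Qed.

Lemma cv_q u x : converges u x -> q (u n) @[n --> \oo] --> q x.
Proof.
move=> hx.
rewrite (_ : (fun n => q (u n)) = (fun n => q (u n - x) + 2 * ip (u n) x - q x));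
  last first.
  by apply/funext => n; rewrite !ipE (ipC hE x (u n)); ring.
rewrite [X in _ --> X](_ : _ = 0 + 2 * q x - q x); last by ring.
apply: cvgB; last exact: cvg_cst.
by apply: cvgD => //; apply: cvgM; [exact: cvg_cst|exact: cv_ip].
Qed.

Lemma cv_add u v x y : converges u x -> converges v y ->
  converges (fun n => u n + v n) (x + y).
Proof.
move=> hx hy.
apply: (@squeeze_cvgr _ _ _ _ (cst 0) (fun n => 2 * q (u n - x) + 2 * q (v n - y))).
- near=> n; rewrite ip_ge0//= opprD addrACA; exact: q_add.
- exact: cvg_cst.
- rewrite [X in _ --> X](_ : _ = 2 * 0 + 2 * 0 :> R); last by rewrite mulr0 addr0.
  by apply: cvgD; (apply: cvgM; [exact: cvg_cst|]).
Unshelve. all: end_near. Qed.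

Lemma cv_scale u x a : converges u x -> converges (fun n => a *: u n) (a *: x).
Proof.
by apply: (@cv_q0 _ _ _ _ (a ^+ 2)) => n;
  rewrite -scalerBr ipZl// ipZr mulrA -expr2.
Qed.

Lemma cv_cst x : converges (cst x) x.
Proof. by rewrite /converges /cst subrr ip0l; exact: cvg_cst. Qed.

Lemma cv_sub u v x y : converges u x -> converges v y ->
  converges (fun n => u n - v n) (x - y).
Proof.
move=> hx hy; rewrite -scaleN1r.
rewrite (_ : (fun n => _) = (fun n => u n + (-1) *: v n)).
  by apply: cv_add => //; exact: cv_scale.
by apply/funext => n; rewrite scaleN1r.
Qed.

Lemma cv_ip2 u v x y : converges u x -> converges v y ->
  ip (u n) (v n) @[n --> \oo] --> ip x y.
Proof.
move=> hx hy.
rewrite (_ : (fun n => _) = (fun n => (q (u n + v n) - q (u n) - q (v n)) / 2));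
  last first.
  by apply/funext => n; rewrite !ipE (ipC hE (v n)); field.
rewrite [X in _ --> X](_ : _ = (q (x + y) - q x - q y) / 2); last first.
  by rewrite !ipE (ipC hE y); field.
apply: cvgM; last exact: cvg_cst.
by do 2?apply: cvgB; apply: cv_q => //; exact: cv_add.
Qed.

Lemma cv_subseq u x k : {homo k : m n / (m < n)%N} -> converges u x ->
  converges (u \o k) x.
Proof. by move=> /homo_cvgy hk hx; exact: cvg_comp hk hx. Qed.

Lemma cv_near u v x : converges u x -> q (u n - v n) @[n --> \oo] --> (0 : R) ->
  converges v x.
Proof.
move=> hx hxy.
have h0 : converges (fun n => u n - v n) 0.
  by rewrite /converges; under eq_fun do rewrite subr0.
have := cv_sub hx h0; rewrite subr0; congr converges.
by apply/funext => n; rewrite opprB addrC subrK.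
Qed.

Lemma cv_cauchy u x : converges u x -> forall e, 0 < e -> exists N, forall m n,
  (N <= m)%N -> (N <= n)%N -> q (u m - u n) < e.
Proof.
move=> hx e e0.
have e4 : 0 < e / 4 by rewrite divr_gt0.
move/cvgrPdist_lt/(_ _ e4) : hx => [N _ hN]; exists N => m n /hN/= + /hN/=.
rewrite !sub0r !normrN !ger0_norm ?ip_ge0// => hm hn.
have -> : u m - u n = (u m - x) + (x - u n) by rewrite addrA subrK.
by apply: (le_lt_trans (q_add _ _)); rewrite (qB x); lra.
Qed.

(** Serves to pull convergence of S v back to v on a subspace where S is bounded below. *)
Lemma complete_from u v (c : R) : 0 < c -> 
  (forall m n, q (v m - v n) <= c * q (u m - u n)) ->
  forall x, converges u x -> exists y, converges v y.
Proof.
move=> c0 h x hx; apply: ip_complete => // e e0.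
have [|N hN] := cv_cauchy hx (e := e / c); first by rewrite divr_gt0.
exists N => m n hm hn; apply: (le_lt_trans (h _ _)).
by rewrite -ltr_pdivlMl// mulrC hN.
Qed.

Lemma subspaceZ H a x : subspace H -> H x -> H (a *: x).
Proof. by move=> hH hx; rewrite -[_ *: _]addr0; apply: subspaceP => //;
  exact: subspace0. Qed.

Lemma subspaceD H x y : subspace H -> H x -> H y -> H (x + y).
Proof. by move=> hH hx hy; rewrite -[x]scale1r; exact: subspaceP. Qed.

Lemma subspaceN H x : subspace H -> H x -> H (- x).
Proof. by move=> hH hx; rewrite -scaleN1r; exact: subspaceZ. Qed.

Lemma subspaceB H x y : subspace H -> H x -> H y -> H (x - y).
Proof. by move=> hH hx hy; apply: subspaceD => //; exact: subspaceN. Qed.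

Lemma closed_subspace_null H x y : closed_subspace H -> H x -> q (x - y) = 0 -> H y.
Proof.
move=> hH hx hxy; apply: (csub_closed hH (u := cst x)) => //.
by rewrite /converges /= hxy; exact: cvg_cst.
Qed.

Lemma orth_csub M : closed_subspace (orth M).
Proof.
split; first split => [y|a x y hx hy z hz].
- by rewrite ip0l.
- by rewrite !ipE hx// hy// mulr0 addr0.
- move=> u x hu hx y hy.
  have := cv_ip (y := y) hx; under eq_fun do rewrite hu//.
  by move=> /(@cvg_lim _ (@Rhausdorff R)) <-; rewrite lim_cst//.
Qed.

Lemma setI_csub H K : closed_subspace H -> closed_subspace K ->
  closed_subspace (H `&` K).
Proof.
move=> hH hK; split; first split.
- by split; apply: subspace0; apply: csub_sub.
- by move=> a x y [? ?] [? ?]; split; apply: subspaceP => //; apply: csub_sub.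
- by move=> u x h hx; split; [apply: (csub_closed hH) hx|apply: (csub_closed hK)
    hx] => n; case: (h n).
Qed.

Lemma sym_lin H S a x y z : subspace H -> symmetric_on H S -> H x -> H y -> H z ->
  ip (S (a *: x + y)) z = ip (a *: S x + S y) z.
Proof.
move=> hH hS hx hy hz; rewrite (sym_ip hS)//; last exact: subspaceP.
by rewrite !ipE !(sym_ip hS).
Qed.

(** Symmetry moves S to the other argument, where the form itself supplies linearity. The defect
    thus is orthogonal to H, and it lies in H, so it is orthogonal to itself. *)
Lemma sym_linq H S a x y : subspace H -> symmetric_on H S -> H x -> H y ->
  q (S (a *: x + y) - (a *: S x + S y)) = 0.
Proof.
move=> hH hS hx hy.
have hz : H (S (a *: x + y) - (a *: S x + S y)).
  by apply: subspaceB => //; [apply: (sym_stable hS)|]; apply: subspaceP => //;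
    exact: (sym_stable hS).
by rewrite ipDl// ipNl (sym_lin _ hH hS)// -ipNl -ipDl// subrr ip0l.
Qed.

Lemma sym_subq H S x y : subspace H -> symmetric_on H S -> H x -> H y ->
  q (S (x - y) - (S x - S y)) = 0.
Proof.
move=> hH hS hx hy; have := sym_linq (-1) hH hS hy hx.
by rewrite !scaleN1r ![- _ + _]addrC.
Qed.

Lemma sym_bound_pos H S : symmetric_on H S ->
  exists2 C, 0 < C & forall x, H x -> q (S x) <= C * q x.
Proof.
move=> [_ _ [C hC]]; exists (`|C| + 1) => [|x hx]; first by rewrite ltr_wpDl.
apply: (le_trans (hC x hx)); rewrite ler_wpM2r ?ip_ge0//.
by rewrite (le_trans (ler_norm _))// lerDl.
Qed.

Lemma cv_sym H S u x : subspace H -> symmetric_on H S -> (forall n, H (u n)) ->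
  H x -> converges u x -> converges (S \o u) (S x).
Proof.
move=> hH hS hu hx cx; have [C _ hC] := sym_bound_pos hS.
apply: (@cv_q0 _ _ _ _ C) cx => n /=.
by rewrite -(null_q (sym_subq hH hS (hu n) hx)) hC//; exact: subspaceB.
Qed.

Lemma sym_sub H K S : K `<=` H -> (forall x, K x -> K (S x)) ->
  symmetric_on H S -> symmetric_on K S.
Proof.
move=> KH hK [h1 h2 [C h3]]; split => // [x y /KH hx /KH hy|]; first exact: h2.
by exists C => x /KH; exact: h3.
Qed.

Lemma compact_sub H K S : K `<=` H -> compact_on H S -> compact_on K S.
Proof. by move=> KH h u hx; apply: h => n; exact: KH. Qed.

Lemma sym_formZ H S a x : subspace H -> symmetric_on H S -> H x ->
  ip (S (a *: x)) (a *: x) = a ^+ 2 * ip (S x) x.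
Proof.
move=> hH hS hx; rewrite (sym_ip hS) ?ipZl//; try exact: subspaceZ.
by rewrite -(sym_ip hS) ?ipZr//; [ring|exact: subspaceZ].
Qed.

Lemma normalize x : q x != 0 -> exists2 a, 0 < a & q (a *: x) = 1.
Proof.
move=> qx; have qp : 0 < q x by rewrite lt_neqAle eq_sym qx ip_ge0.
exists (Num.sqrt (q x))^-1; first by rewrite invr_gt0 sqrtr_gt0.
by rewrite !ipE mulrA -expr2 exprVn sqr_sqrtr ?ip_ge0// mulVf.
Qed.

End SemiHilbert.

(** * The projection theorem and Riesz representation *)

Section Projection.
Context (R : realType) (E : lmodType R) (ip : E -> E -> R).
Hypothesis hE : semi_hilbert ip.
Implicit Types (x y z : E) (u v : nat -> E) (H K M : set E) (S T : E -> E).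
Local Notation q x := (ip x x).
Local Notation ipE := (ipE hE).

Lemma projection_closure M x : subspace M -> exists p,
  orth ip M (x - p) /\ exists2 u, (forall n, M (u n)) & converges ip u p.
Proof.
move=> hM.
pose A := [set q (x - y) | y in M].
have A0 : A !=set0 by exists (q (x - 0)); exists 0 => //; exact: subspace0.
have lbA : has_lbound A by exists 0 => _ [y _ <-]; exact: ip_ge0.
have infA : has_inf A by split.
pose d := inf A.
have dle y : M y -> d <= q (x - y) by move=> hy; apply: ge_inf => //; exists y.
have /choice [u hu] : forall n, exists y, M y /\ q (x - y) < d + n.+1%:R^-1.
  move=> n; have [|_ [y hy <-] h] := @inf_adherent _ A n.+1%:R^-1 _ infA.
    by rewrite invr_gt0.
  by exists y.
have huM n : M (u n) by case: (hu n).
have [|p hp] := ip_complete hE (u := u).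
  move=> e e0.
  have e4 : 0 < e / 4 by rewrite divr_gt0.
  have /cvgrPdist_lt/(_ _ e4)[N _ hN] := @cvg_harmonic R.
  exists N => m n /hN/= + /hN/=.
  rewrite !sub0r !normrN !ger0_norm ?invr_ge0// => hm hn.
  have [_ hm'] := hu m; have [_ hn'] := hu n.
  (* The midpoint lies in M, so the parallelogram law bounds q (u m - u n) by the excess of the two
     squared distances over d. *)
  have := dle (2^-1 *: (u m + u n)) _.
  have -> : q (x - 2^-1 *: (u m + u n)) =
    (2 * q (x - u m) + 2 * q (x - u n) - q (u m - u n)) / 4.
    by rewrite !ipE (ipC hE x) (ipC hE x (u n)) (ipC hE (u n) (u m)); field.
  move=> /(_ (subspaceZ _ hM (subspaceD hM (huM m) (huM n)))) hd.
  move: hm hn hm' hn' hd; rewrite /harmonic /=.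
  move: (m.+1%:R^-1) (n.+1%:R^-1) (q (x - u m)) (q (x - u n)) (q (u m - u n))
    => a b r s t.
  by lra.
exists p; split; last by exists u.
have hxp : converges ip (fun n => x - u n) (x - p) by apply: cv_sub => //;
  exact: cv_cst.
move=> h hh.
(* Moving u n by t *: h cannot go below d, and u n is within 1 / (n + 1) of d; this slack vanishes
   in the limit. *)
have key t : 0 <= 0 - 2 * t * ip (x - p) h + t ^+ 2 * q h.
  rewrite -subr_ge0 subr0.
  have hl : (n.+1%:R^-1 - 2 * t * ip (x - u n) h + t ^+ 2 * q h) @[n --> \oo] -->
      (0 - 2 * t * ip (x - p) h + t ^+ 2 * q h).
    apply: cvgD; last exact: cvg_cst.
    apply: cvgB; first exact: cvg_harmonic.
    by apply: cvgM; [exact: cvg_cst|exact: cv_ip].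
  have cl : 0 <= lim ((n.+1%:R^-1 - 2 * t * ip (x - u n) h + t ^+ 2 * q h)
    @[n --> \oo]).
    apply: limr_ge; first by apply/cvg_ex; eexists; exact: hl.
    near=> n.
    have := dle (u n + t *: h) (subspaceD hM (huM n) (subspaceZ _ hM hh)).
    have [_ hn'] := hu n.
    have -> : q (x - (u n + t *: h)) = q (x - u n) - 2 * t * ip (x - u n)
      h + t ^+ 2 * q h.
      by rewrite !ipE (ipC hE h x) (ipC hE h (u n)) (ipC hE (u n) x); ring.
    move: hn'; move: (n.+1%:R^-1) => a; lra.
  by move: cl; rewrite (cvg_lim (@Rhausdorff R) hl).
have := discriminant_le (ip_ge0 hE h) key; rewrite mul0r => h0.
by apply/eqP; rewrite -sqrf_eq0; apply/eqP/le_anti; rewrite h0 sqr_ge0.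
Unshelve. all: end_near. Qed.

Lemma projection M x : closed_subspace ip M -> exists2 p, M p & orth ip M (x - p).
Proof.
move=> hM; have [p [h1 [u hu hp]]] := projection_closure x (csub_sub hM).
by exists p => //; exact: csub_closed hM _ _ hu hp.
Qed.

Lemma riesz (phi : E -> R) (C : R) :
  (forall a x y, phi (a *: x + y) = a * phi x + phi y) ->
  (forall x, phi x ^+ 2 <= C * q x) -> exists h, forall x, phi x = ip x h.
Proof.
move=> phil phib.
have phi0 x : q x = 0 -> phi x = 0.
  move=> qx; apply/eqP; rewrite -sqrf_eq0; apply/eqP/le_anti.
  by rewrite sqr_ge0 andbT (le_trans (phib x))// qx mulr0.
have phi00 : phi 0 = 0 by apply: phi0; rewrite ip0l.
have phiZ a x : phi (a *: x) = a * phi x by rewrite -[a *: x]addr0 phil phi00 addr0.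
have phiB x y : phi (x - y) = phi x - phi y.
  by rewrite addrC -scaleN1r phil mulN1r addrC.
have [|/existsNP[x0 hx0]] := pselect (forall x, phi x = 0).
  by move=> h; exists 0 => x; rewrite h ip0r.
pose M := [set x | phi x = 0].
have hM : closed_subspace ip M.
  split; first by split=> [//|a x y]; rewrite /M/= phil => -> ->;
    rewrite mulr0 addr0.
  move=> u x hu hx; rewrite /M/=.
  have : phi (u n - x) @[n --> \oo] --> (0 : R).
    apply: cvg_sqr0; apply: (@squeeze_cvgr _ _ _ _ (cst 0)
      (fun n => C * q (u n - x))).
    - by near=> n; rewrite sqr_ge0/= phib.
    - exact: cvg_cst.
    - by rewrite -[X in _ --> X](mulr0 C); apply: cvgM => //; exact: cvg_cst.
  under eq_fun do rewrite phiB hu sub0r.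
  move=> /(cvg_lim (@Rhausdorff R)); rewrite lim_cst// => /eqP.
  by rewrite oppr_eq0 => /eqP.
have [p hp hxp] := projection x0 hM.
have [z hz phiz] : exists2 z, orth ip M z & phi z = phi x0.
  by exists (x0 - p) => //; rewrite phiB hp subr0.
have qz : q z != 0 by apply/eqP => /phi0; rewrite phiz.
(* Modulo the kernel M every x is a multiple of z, and z is orthogonal to M; the case x = z fixes
   the factor. *)
exists ((phi z / q z) *: z) => x.
have : M (x - (phi x / phi z) *: z).
  by rewrite /M/= phiB phiZ divfK ?subrr// phiz; apply/eqP.
move=> /hz; rewrite ipZr// !ipE => /eqP; rewrite subr_eq0 (ipC hE x) => /eqP ->.
have pz : phi z != 0 by rewrite phiz; apply/eqP.
by field; rewrite qz pz.
Unshelve. all: end_near. Qed.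

End Projection.

(** * Orthogonal projections, given as choices of representatives *)

Section OrthogonalProjection.
Context (R : realType) (E : lmodType R) (ip : E -> E -> R).
Hypothesis hE : semi_hilbert ip.
Implicit Types x y z : E.
Local Notation q x := (ip x x).
Local Notation ipE := (ipE hE).
Context (H M : set E) (p : E -> E).
Hypotheses (sH : subspace H) (sM : subspace M).
Hypothesis pM : forall x, H x -> M (p x).
Hypothesis pO : forall x, H x -> orth ip M (x - p x).

Lemma proj_ip x y : H x -> M y -> ip (p x) y = ip x y.
Proof.
by move=> hx hy; have /eqP := pO hx hy; rewrite !ipE subr_eq0 => /eqP.
Qed.

Lemma proj_q x : H x -> q (p x) = ip (p x) x.
Proof. by move=> hx; rewrite proj_ip ?(ipC hE x)//; exact: pM. Qed.

Lemma pythagoras x : H x -> q x = q (p x) + q (x - p x).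
Proof. by move=> hx; have := proj_q hx; rewrite !ipE (ipC hE x (p x)); lra. Qed.

Lemma proj_contr x : H x -> q (p x) <= q x.
Proof. by move=> hx; rewrite (pythagoras hx) lerDl ip_ge0. Qed.

Lemma proj_unique x w : H x -> M w -> orth ip M (x - w) -> q (p x - w) = 0.
Proof.
move=> hx hw ow; have hpx := pM hx.
have hd : M (p x - w) by exact: subspaceB.
rewrite ipDl// (proj_ip hx hd) -ipDl//; exact: ow.
Qed.

Lemma proj_linear a x y : H x -> H y -> q (p (a *: x + y) - (a *: p x + p y)) = 0.
Proof.
move=> hx hy; apply: proj_unique; [exact: subspaceP|apply: subspaceP => //;
  exact: pM|].
rewrite opprD addrACA -scalerBr.
by move: (pO hx) (pO hy); apply: subspaceP; exact: csub_sub (orth_csub hE _).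
Qed.

Lemma proj_qZ a x : H x -> q (p (a *: x)) = a ^+ 2 * q (p x).
Proof.
move=> hx; rewrite (null_q hE (proj_unique (w := a *: p x) _ _ _)).
- by rewrite !ipE; ring.
- exact: subspaceZ.
- by apply: subspaceZ => //; exact: pM.
- by rewrite -scalerBr; move: (pO hx); apply: subspaceZ;
    exact: csub_sub (orth_csub hE _).
Qed.

(** The cross term contains y instead of p y: it is then an inner product of y with a fixed vector,
    which can be averaged over the group. *)
Lemma proj_qD x y : H x -> H y ->
  q (p (x + y)) = q (p x) + 2 * ip (p x) y + q (p y).
Proof.
move=> hx hy; have := proj_linear 1 hx hy; rewrite !scale1r => /(null_q hE) ->.
have e : ip (p x) (p y) = ip (p x) y by rewrite (ipC hE _ (p y))
  (proj_ip hy (pM hx)) (ipC hE).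
by rewrite !ipE (ipC hE (p y) (p x)) e; ring.
Qed.

Lemma proj_null x y : H x -> H y -> q (x - y) = 0 -> q (p x - p y) = 0.
Proof.
move=> hx hy hxy; apply: proj_unique => // [|z hz]; first exact: pM.
by rewrite ipDl// (null_eq hE _ hxy) -ipDl//; exact: pO.
Qed.

Lemma proj_id x : H x -> M x -> q (p x - x) = 0.
Proof. by move=> hx mx; apply: proj_unique => // z _; rewrite subrr ip0l. Qed.

End OrthogonalProjection.

(** * Compact symmetric operators *)

Section Spectral.
Context (R : realType) (E : lmodType R) (ip : E -> E -> R).
Hypothesis hE : semi_hilbert ip.
Implicit Types (x y z : E) (u v : nat -> E) (H K M : set E) (S T A : E -> E).
Local Notation q x := (ip x x).
Local Notation ipE := (ipE hE).

Lemma homogeneous_le H S (c : R) : subspace H -> symmetric_on ip H S ->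
  (forall x, H x -> q x = 1 -> ip (S x) x <= c) ->
  forall x, H x -> ip (S x) x <= c * q x.
Proof.
move=> hH hS h x hx; have [qx|qx] := eqVneq (q x) 0.
  by rewrite qx mulr0 ipC// (null_ip hE).
have [a a0 ha] := normalize hE qx.
have := h _ (subspaceZ a hH hx) ha.
rewrite (sym_formZ hE a hH hS hx).
move: ha; rewrite !ipE mulrA -expr2 => ha h1.
have a2 : 0 < a ^+ 2 by rewrite exprn_gt0.
by rewrite -(ler_pM2l a2) mulrCA ha mulr1.
Qed.

Lemma form_sup H S : subspace H -> symmetric_on ip H S ->
  (exists2 x, H x & q x != 0) ->
  exists2 s, forall x, H x -> ip (S x) x <= s * q x &
    forall e, 0 < e -> exists x, [/\ H x, q x = 1 & s - e < ip (S x) x].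
Proof.
move=> hH hS [x0 hx0 qx0].
pose F := [set ip (S x) x | x in H `&` [set x | q x = 1]].
have F0 : F !=set0.
  have [a a0 ha] := normalize hE qx0.
  by exists (ip (S (a *: x0)) (a *: x0)); exists (a *: x0) => //; split => //;
    exact: subspaceZ.
have [C C0 hC] := sym_bound_pos hE hS.
have ubF : has_ubound F.
  exists (C + 1) => _ [x [hx qx] <-].
  have := cauchy_schwarz hE (S x) x; rewrite qx mulr1 => h.
  have := hC x hx; rewrite qx mulr1 => h'.
  by nra.
exists (sup F).
  apply: homogeneous_le => // x hx qx.
  by apply: sup_upper_bound; [split|exists x].
move=> e e0; have [|_ [x [hx qx] <-] h] := @sup_adherent _ F e e0; first by split.
by exists x.
Qed.

Lemma sym_shift H S a : subspace H -> symmetric_on ip H S ->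
  symmetric_on ip H (fun x => a *: x - S x).
Proof.
move=> hH hS; split=> [x hx|x y hx hy|].
- by apply: subspaceB => //; [exact: subspaceZ|exact: sym_stable hS _ hx].
- by rewrite !ipE (sym_ip hS).
- have [C C0 hC] := sym_bound_pos hE hS; exists (2 * a ^+ 2 + 2 * C) => x hx.
  have := q_add hE (a *: x) (- S x); have := hC x hx; rewrite !ipE; nra.
Qed.

Lemma form_cauchy_schwarz H S : subspace H -> symmetric_on ip H S ->
  (forall x, H x -> 0 <= ip (S x) x) ->
  forall x y, H x -> H y -> ip (S x) y ^+ 2 <= ip (S x) x * ip (S y) y.
Proof.
move=> hH hS S0 x y hx hy; apply: discriminant_le => [|t]; first exact: S0.
have h : H (- t *: y + x) by exact: subspaceP.
have := S0 _ h; rewrite (sym_lin hE _ hH hS)// !ipE.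
rewrite (sym_ip hS hy hx) (ipC hE y); congr (_ <= _); ring.
Qed.

Lemma form_bounded H S : symmetric_on ip H S ->
  exists2 C, 0 < C & forall x, H x -> ip (S x) x <= C * q x.
Proof.
move=> hS; have [C C0 hC] := sym_bound_pos hE hS.
exists (C + 1) => [|x hx]; first by rewrite addr_gt0.
have qx := ip_ge0 hE x.
have h : ip (S x) x ^+ 2 <= ((C + 1) * q x) ^+ 2.
  apply: (le_trans (cauchy_schwarz hE (S x) x)).
  apply: (le_trans (ler_wpM2r qx (hC x hx))).
  rewrite exprMn -[leLHS]mulrA -expr2; apply: ler_wpM2r; first exact: sqr_ge0.
  by have := sqr_ge0 C; lra.
rewrite (le_trans (ler_norm _))// -sqrtr_sqr (le_trans (ler_wsqrtr h))//.
by rewrite sqrtr_sqr ger0_norm// mulr_ge0// addr_ge0// ltW.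
Qed.

(** Near-maximizers of the form are near-eigenvectors. For the positive operator T = s - S,
    Cauchy-Schwarz for <T ., .> at x and T x gives |T x|^4 <= <T x, x> <T T x, T x>, and the last
    factor is at most C |T x|^2. *)
Lemma eigen_approx H S s : subspace H -> symmetric_on ip H S ->
  (forall x, H x -> ip (S x) x <= s * q x) ->
  exists2 C, 0 < C &
    forall x, H x -> q (S x - s *: x) <= C * (s * q x - ip (S x) x).
Proof.
move=> hH hS hs; have hT := sym_shift s hH hS.
have [C C0 hC] := form_bounded hT.
exists C => // x hx; rewrite qB//; set T := fun x => s *: x - S x in hT hC.
have T0 y : H y -> 0 <= ip (T y) y by move=> /hs; rewrite /T !ipE subr_ge0.
have hTx := sym_stable hT hx.
have := form_cauchy_schwarz hH hT T0 hx hTx.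
have -> : s * q x - ip (S x) x = ip (T x) x by rewrite /T !ipE.
rewrite -/(T x) expr2 => h.
have [->|qT] := eqVneq (q (T x)) 0; first by rewrite mulr_ge0 ?T0// ltW.
have qp : 0 < q (T x) by rewrite lt_neqAle eq_sym qT ip_ge0.
rewrite -(ler_pM2r qp) (le_trans h)// mulrAC mulrC ler_wpM2r ?T0//.
exact: hC.
Qed.

(** A maximizing sequence u satisfies S u - s u -> 0. Compactness makes S u converge along a
    subsequence, and s != 0 allows dividing to make u itself converge. *)
Lemma eigen_attained H S s : closed_subspace ip H -> symmetric_on ip H S ->
  compact_on ip H S -> s != 0 ->
  (forall x, H x -> ip (S x) x <= s * q x) ->
  (forall e, 0 < e -> exists x, [/\ H x, q x = 1 & s - e < ip (S x) x]) ->
  exists x, [/\ H x, q x = 1 & q (S x - s *: x) = 0].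
Proof.
move=> hH hS cS s0 hs hsup; have sH := csub_sub hH.
have [C C0 hC] := eigen_approx sH hS hs.
have /choice [u hu] : forall n, exists x, [/\ H x,
  q x = 1 & s - n.+1%:R^-1 < ip (S x) x].
  by move=> n; apply: hsup; rewrite invr_gt0.
have Hu n : H (u n) by case: (hu n).
have qu n : q (u n) = 1 by case: (hu n).
have d0 : q (S (u n) - s *: u n) @[n --> \oo] --> (0 : R).
  apply: (@cvg0_le_const _ _ C) => n; rewrite ip_ge0//=.
  apply: (le_trans (hC _ (Hu n))); rewrite ler_wpM2l ?(ltW C0)// qu mulr1.
  have [_ _] := hu n; move: (n.+1%:R^-1) => a; lra.
have [|k hk [y hy]] := cS u Hu; first by exists 1 => n; rewrite qu.
have d1 : q (S (u (k n)) - s *: u (k n)) @[n --> \oo] --> (0 : R).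
  exact: cvg_comp (homo_cvgy hk) d0.
have hsu : converges ip (fun n => s *: u (k n)) y := cv_near hE hy d1.
have hx : converges ip (u \o k) (s^-1 *: y).
  have := cv_scale hE s^-1 hsu; congr converges.
  by apply/funext => n; rewrite scalerA mulVf// scale1r.
have Hx : H (s^-1 *: y) by apply: csub_closed hH _ _ _ hx => n; exact: Hu.
have hSx := cv_sym hE sH hS (fun n => Hu (k n)) Hx hx.
exists (s^-1 *: y); split => //.
  have := cv_q hE hx; rewrite (_ : (fun n => _) = cst 1).
    by move=> /(cvg_lim (@Rhausdorff R)) <-; rewrite lim_cst.
  by apply/funext => n /=; rewrite qu.
have := cv_q hE (cv_sub hE hSx hsu).
move/(cvg_lim (@Rhausdorff R)); rewrite (cvg_lim (@Rhausdorff R) d1) => h.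
by rewrite scalerA mulfV// scale1r.
Qed.

(* With m_k = <A^k h, h>, Cauchy-Schwarz gives m_2^2 <= m_1 m_3, so the
   hypothesis e m_1 <= m_2 propagates to e m_2 <= m_3: the conclusion holds on
   the range of A, which is dense because A is injective. *)
Lemma bounded_below H A (e : R) : closed_subspace ip H -> symmetric_on ip H A ->
  (forall x, H x -> 0 <= ip (A x) x) ->
  (forall x, H x -> q (A x) = 0 -> q x = 0) ->
  0 <= e -> (forall x, H x -> e * ip (A x) x <= q (A x)) ->
  forall x, H x -> e * q x <= ip (A x) x.
Proof.
move=> hH hA A0 Ai e0 hAe x hx; have sH := csub_sub hH.
have onrange h : H h -> e * q (A h) <= ip (A (A h)) (A h).
  move=> hh; have hAh := sym_stable hA hh.
  have m1 := A0 _ hh; have m3 := A0 _ hAh; have := hAe _ hh.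
  have := form_cauchy_schwarz sH hA A0 hh hAh.
  have := ip_ge0 hE (A h).
  move: (q (A h)) (ip (A h) h) (ip _ _) m1 m3 => m2 m1 m3 h1 h3 h2 cs he.
  have [->|m2n] := eqVneq m2 0; first by rewrite mulr0.
  have m2p : 0 < m2 by rewrite lt_neqAle eq_sym m2n.
  rewrite -(ler_pM2r m2p); apply: le_trans (ler_wpM2l h3 he).
  by rewrite -mulrA -expr2 [leRHS]mulrCA ler_wpM2l// mulrC.
(* The range of A saturated by null vectors; without saturation it need not be a subspace, A being
   linear only up to null vectors. *)
pose M := [set y | H y /\ exists2 h, H h & q (A h - y) = 0].
have hM : subspace M.
  split.
    split; first exact: subspace0 sH.
    exists 0; first exact: subspace0 sH.
    rewrite subr0; have hA0 := sym_stable hA (subspace0 sH).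
    by rewrite (sym_ip hA) ?ip0l//; exact: subspace0 sH.
  move=> a y z [hy [h hh hhy]] [hz [k hk hkz]]; split; first exact: subspaceP.
  exists (a *: h + k); first exact: subspaceP.
  rewrite (null_sub hE _ (sym_linq hE a sH hA hh hk)) opprD addrACA -scalerBr.
  move: (A h - y) (A k - z) hhy hkz => d1 d2 h1 h2.
  by rewrite !ipE h1 h2 (null_ip hE _ h1) (null_ip hE _ h2) !(mulr0, addr0).
have [p [ho [u hu hp]]] := projection_closure hE x hM.
have Hp : H p by apply: csub_closed hH _ _ _ hp => n; case: (hu n).
have qxp : q (x - p) = 0.
  (* The vector x - p is orthogonal to the range, in particular to A (A (x - p)), so by symmetry A
     (x - p) is null. *)
  apply: Ai; first exact: subspaceB.
  have hxp : H (x - p) by exact: subspaceB.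
  have hAxp := sym_stable hA hxp.
  rewrite (sym_ip hA)//; apply: ho; split; first exact: sym_stable hA _ hAxp.
  by exists (A (x - p)) => //; rewrite subrr ip0l.
rewrite (null_q hE qxp).
have -> : ip (A x) x = ip (A p) p.
  rewrite ipC// (null_eq hE _ qxp) -(sym_ip hA)// ipC// (null_eq hE _ qxp).
  by rewrite -(sym_ip hA).
have Hu n : H (u n) by case: (hu n).
have l1 := cv_ip2 hE (cv_sym hE sH hA Hu Hp hp) hp.
have l2 : e * q (u n) @[n --> \oo] --> e * q p.
  by apply: cvgM; [exact: cvg_cst|exact: cv_q].
apply: (ler_cvg_to l2 l1); near=> n.
have [hun [h hh hq]] := hu n; have hAh := sym_stable hA hh; rewrite /=.
rewrite -(null_q hE hq) (sym_ip hA hun hun) -(null_eq hE _ hq).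
by rewrite -(sym_ip hA hAh hun) (ipC hE _ (u n)) -(null_eq hE _ hq)
  (ipC hE (A h) (A (A h))) onrange.
Unshelve. all: end_near. Qed.


(** The supremum of the form of S may be 0 without being attained, so [eigen_attained] is applied to
    T = -e S - S^2 instead. A positive supremum of its form would produce an eigenvalue of S in ]-e,
    0[. Hence T <= 0, that is e <A x, x> <= |A x|^2 for A = -S, and [bounded_below] turns this into
    e |x|^2 <= <A x, x>. *)
Lemma negative_gap H S (e : R) : closed_subspace ip H -> symmetric_on ip H S ->
  compact_on ip H S -> 0 < e ->
  (forall x, H x -> ip (S x) x <= 0) ->
  (forall c x, - e < c -> c <= 0 -> eigen_on ip H S c x -> q x = 0) ->
  forall x, H x -> ip (S x) x <= - e * q x.
Proof.
move=> hH hS cS e0 S0 noeig; have sH := csub_sub hH.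
pose T x := - e *: S x - S (S x).
have TE x : H x -> ip (T x) x = - e * ip (S x) x - q (S x).
  by move=> hx; rewrite !ipE (sym_ip hS (sym_stable hS hx) hx).
have hT : symmetric_on ip H T.
  split=> [x hx|x y hx hy|].
  - have hSx := sym_stable hS hx.
    by apply: subspaceB => //; [exact: subspaceZ|exact: sym_stable hS _ hSx].
  - have hSx := sym_stable hS hx; have hSy := sym_stable hS hy.
    by rewrite !ipE !(sym_ip hS).
  - have [C C0 hC] := sym_bound_pos hE hS;
      exists (2 * e ^+ 2 * C + 2 * C * C) => x hx.
    have := q_add hE (- e *: S x) (- S (S x)).
    have := hC _ (sym_stable hS hx); have := hC x hx; rewrite !ipE.
    have := ip_ge0 hE x; nra.
have cT : compact_on ip H T.
  move=> u hu bu; have [k hk [y hy]] := cS u hu bu.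
  exists k => //; exists (- e *: y - S y).
  apply: cv_sub => //; first exact: cv_scale.
  apply: (cv_sym hE sH hS) => // [n|]; first exact: sym_stable hS _ (hu _).
  by apply: csub_closed hH _ _ _ hy => n; exact: sym_stable hS _ (hu _).
have T0 x : H x -> ip (T x) x <= 0.
  have [|h] := pselect (exists2 x, H x & q x != 0); last first.
    move=> hx; have [/(null_ip hE) h0|qx] := eqVneq (q x) 0; last by case: h;
      exists x.
    by rewrite ipC// h0.
  move=> /(form_sup sH hT)[t ht tsup] hx.
  apply: (le_trans (ht x hx)).
  have [t0|t0] := leP t 0; first by rewrite mulr_le0_ge0 ?ip_ge0.
  have [y [hy qy Ty]] := eigen_attained hH hT cT (lt0r_neq0 t0) ht tsup.
  exfalso.
  have hSy := sym_stable hS hy.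
  (* S^2 + e S + t kills y: the roots of z^2 + e z + t lie in ]-e, 0[. *)
  have et : 0 <= e ^+ 2 / 4 - t.
    (* By [TE] and T y = t y, the squared norm of S y + (e / 2) y is exactly e^2 / 4 - t. *)
    have := ip_ge0 hE (S y + (e / 2) *: y).
    have /eqP := TE y hy; rewrite (null_eq hE _ Ty) !ipE qy (ipC hE y) => /eqP; nra.
  pose r := Num.sqrt (e ^+ 2 / 4 - t).
  have rr : r ^+ 2 = e ^+ 2 / 4 - t by rewrite sqr_sqrtr.
  have r0 : 0 <= r by exact: sqrtr_ge0.
  have re : r < e / 2 by nra.
  (* The two factors of the quadratic are applied in turn: S - (r - e / 2) kills z, so z is null by
     [noeig]; this says that S + (e / 2 + r) kills y, so y is null as well. *)
  pose z := (e / 2 + r) *: y + S y.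
  have hz : H z by exact: subspaceP.
  have qz : q z = 0.
    apply: (noeig (r - e / 2)); [by lra|by lra|split=> //].
    rewrite (null_sub hE _ (sym_linq hE _ sH hS hy hSy)).
    rewrite -[RHS]Ty [RHS]qB//.
    have -> : (e / 2 + r) *: S y + S (S y) - (r - e / 2) *: z = t *: y - T y.
      rewrite /T; have -> : - e *: S y = - ((e / 2 + r) *: S y - (r - e / 2)
        *: S y).
        by rewrite -scalerBl -scaleNr; congr (_ *: _); field.
      rewrite /z scalerDr scalerA.
      have -> : (r - e / 2) * (e / 2 + r) = - t.
        by transitivity (r ^+ 2 - e ^+ 2 / 4); [field|rewrite rr; ring].
      rewrite scaleNr; move: (_ *: S y) (_ *: S y) (t *: y) (S (S y)) => P B Q V.
      rewrite !opprD !opprK addrACA [B + Q]addrC -!addrA; congr (_ + (_ + _)).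
      by rewrite addrC.
    by [].
  have : q y = 0.
    apply: (noeig (- (e / 2 + r))); [by lra|by lra|split=> //].
    by rewrite scaleNr opprK addrC.
  by rewrite qy; apply/eqP; rewrite oner_eq0.
have hA : symmetric_on ip H (fun x => 0 *: x - S x) := sym_shift 0 sH hS.
move=> x hx; have := @bounded_below H _ e hH hA.
have AE y : ip (0 *: y - S y) y = - ip (S y) y by rewrite !ipE mul0r sub0r.
have qA y : q (0 *: y - S y) = q (S y) by rewrite scale0r sub0r !ipE opprK.
move=> /(_ _ _ (ltW e0) _ x hx); rewrite AE => h; rewrite mulNr lerNr h// => y hy.
- by rewrite AE oppr_ge0 S0.
- rewrite qA => qS; apply: (noeig 0); [by rewrite oppr_lt0|by []|split=> //].
  by rewrite scale0r subr0.
- by rewrite AE qA; have := T0 y hy; rewrite TE// subr_le0 mulNr mulrN.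
Qed.

End Spectral.

(** * The form off the top eigenspace, and the angle to that eigenspace *)

Section Gap.
Context (R : realType) (E : lmodType R) (ip : E -> E -> R).
Hypothesis hE : semi_hilbert ip.
Implicit Types (x y z : E) (u v : nat -> E).
Local Notation q x := (ip x x).
Local Notation ipE := (ipE hE).
Context (H : set E) (S : E -> E) (s1 s2 : R).
Hypotheses (hH : closed_subspace ip H) (hS : symmetric_on ip H S).
Hypotheses (cS : compact_on ip H S) (s21 : s2 < s1).
Hypothesis S_le : forall x, H x -> ip (S x) x <= s1 * q x.
Hypothesis noeig : forall c x, s2 < c -> c < s1 -> eigen_on ip H S c x -> q x = 0.
Local Notation W := (eigen_on ip H S s1).
Let sH := csub_sub hH.

Lemma eigen_csub c : closed_subspace ip (eigen_on ip H S c).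
Proof.
split; first split.
- split; first exact: subspace0 sH.
  rewrite scaler0 subr0 (sym_ip hS) ?ip0l//; first exact: subspace0 sH.
  exact: sym_stable hS _ (subspace0 sH).
- move=> a x y [hx qx] [hy qy]; split; first exact: subspaceP.
  rewrite (null_sub hE _ (sym_linq hE a sH hS hx hy)).
  rewrite scalerDr scalerA (mulrC c) -scalerA opprD addrACA -scalerBr.
  move: (S x - _) (S y - _) qx qy => d1 d2 h1 h2.
  by rewrite !ipE h1 h2 (null_ip hE _ h1) (null_ip hE _ h2) !(mulr0, addr0).
- move=> u x hu hx; have Hu n : H (u n) by case: (hu n).
  have Hx : H x by exact: csub_closed hH _ _ Hu hx.
  split => //.
  have := cv_q hE (cv_sub hE (cv_sym hE sH hS Hu Hx hx) (cv_scale hE c hx)).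
  rewrite (_ : (fun n => _) = cst 0); last by apply/funext => n /=; case: (hu n).
  by move=> /(cvg_lim (@Rhausdorff R)) <-; rewrite lim_cst.
Qed.

Lemma orth_eigen_stable x : H x -> orth ip W x -> orth ip W (S x).
Proof.
move=> hx ox w [hw qw]; rewrite (sym_ip hS)// ipC// (null_eq hE _ qw) !ipE.
by rewrite (ipC hE) ox ?mulr0.
Qed.

(** Let t be the supremum of the form over unit vectors of H orthogonal to W, and suppose t > s2. If
    t is nonzero it is attained at an eigenvector: t < s1 contradicts [noeig], and t = s1 puts a
    unit vector into both W and its complement. *)
Lemma gap_orth x : H x -> orth ip W x -> ip (S x) x <= s2 * q x.
Proof.
pose H' := H `&` orth ip W.
have hH' : closed_subspace ip H' by apply: setI_csub => //; exact: orth_csub.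
have H'H : H' `<=` H by move=> y [].
have H'S y : H' y -> H' (S y).
  by move=> [hy oy]; split; [exact: sym_stable hS _ hy|exact: orth_eigen_stable].
have hS' : symmetric_on ip H' S := sym_sub H'H H'S hS.
have cS' : compact_on ip H' S := compact_sub H'H cS.
move=> hx ox; have [qx|qx] := eqVneq (q x) 0.
  by rewrite qx mulr0 ipC// (null_ip hE).
have [|t ht tsup] := form_sup hE (csub_sub hH') hS'; first by exists x.
have W0 y : H' y -> q (S y - s1 *: y) = 0 -> q y = 0.
  by move=> [hy oy] h; exact: oy.
apply: (le_trans (ht x _)) => //; rewrite ler_wpM2r ?ip_ge0//.
have [//|s2t] := leP t s2; exfalso.
have ts1 : t <= s1.
  apply/ler_addgt0Pr => e e0; have [y [[hy _] qy]] := tsup e e0.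
  by have := S_le hy; rewrite qy; lra.
(* Here t = 0 may fail to be attained, but s2 < 0, and [negative_gap] with e = - s2 bounds the form
   by s2 directly. *)
have [t0|t0] := eqVneq t 0.
  have s20 : 0 < - s2 by rewrite oppr_gt0 -t0.
  have := negative_gap hE hH' hS' cS' s20.
  rewrite opprK => h.
  have [y [hy qy]] := tsup _ s20.
  suff : ip (S y) y <= s2 * q y by rewrite qy; lra.
  apply: h => // [z hz|c z c2 c0 [hz qz]].
    by have := ht z hz; rewrite t0 mul0r.
  have [cs1|cs1] := ltP c s1; first by apply: (noeig c2 cs1); split => //;
    exact: H'H.
  by apply: W0 => //; have <- : c = s1 by apply/eqP;
    rewrite eq_le cs1 andbT (le_trans c0)// -t0.
have [y [hy qy hSy]] := eigen_attained hE hH' hS' cS' t0 ht tsup.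
suff : q y = 0 by rewrite qy; apply/eqP; rewrite oner_eq0.
have [ts|ts] := ltP t s1; first by apply: (noeig s2t ts); split => //; exact: H'H.
by apply: W0 => //; have <- : t = s1 by apply/eqP; rewrite eq_le ts ts1.
Qed.

Context (K : set E) (p : E -> E).
Hypotheses (hK : closed_subspace ip K) (KH : K `<=` H).
Hypothesis pW : forall x, H x -> W (p x).
Hypothesis pO : forall x, H x -> orth ip W (x - p x).
Hypothesis KW : forall x, K x -> W x -> q x = 0.
Let sK := csub_sub hK.

Let pyth x : H x -> q x = q (p x) + q (x - p x) :=
  @pythagoras _ _ _ hE H W p pW pO x.

(** Since p x is an eigenvector, the cross terms between p x and x - p x vanish: the form is s1 |p
    x|^2 plus its value at x - p x, which [gap_orth] bounds. *)
Lemma gap_split x : H x -> ip (S x) x <= s2 * q x + (s1 - s2) * q (p x).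
Proof.
move=> hx; have wp := pW hx; have hp : H (p x) by case: wp.
have hr : H (x - p x) by exact: subspaceB.
have := gap_orth hr (pO hx); have := pyth hx.
have e1 y : ip (S (p x)) y = s1 * ip (p x) y.
  by rewrite (null_eq hE _ wp.2) (ipZl hE).
have e2 : ip (p x) (x - p x) = 0 by rewrite (ipC hE); exact: pO.
have -> : ip (S x) x = ip (S (x - p x)) (x - p x) + s1 * q (p x).
  have -> : ip (S (x - p x)) (x - p x) = ip (S x - S (p x)) (x - p x).
    exact: null_eq (sym_subq hE sH hS hx hp).
  rewrite (ipDl hE) (ipNl hE) e1 e2 mulr0 subr0 (ipDr hE x) (ipNr hE (p x)).
  by rewrite (sym_ip hS hx hp) (ipC hE x) e1 (proj_q hE pW pO hx); ring.
by move: (ip (S _) _) => t; nra.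
Qed.

Lemma angle_lt1 : exists2 c, c < 1 & forall x, K x -> q (p x) <= c * q x.
Proof.
have [s10|s10] := eqVneq s1 0; last first.
  (* Unit vectors u n of K with q (p (u n)) -> 1 satisfy u n - p (u n) -> 0. As S acts on p (u n) as
     the nonzero scalar s1, compactness makes a subsequence converge, and its limit is a unit vector
     in both K and W. *)
  apply: contrapT => hn.
  have /choice [u hu] : forall n, exists x, [/\ K x,
    q x = 1 & 1 - n.+1%:R^-1 < q (p x)].
    move=> n; apply: contrapT => h; apply: hn; exists (1 - n.+1%:R^-1).
      by rewrite ltrBlDr ltrDl invr_gt0.
    move=> x hx; have hHx := KH hx.
    have [qx|qx] := eqVneq (q x) 0.
      by have := pyth hHx; have := ip_ge0 hE (x - p x); rewrite qx mulr0; lra.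
    have [a a0 ha] := normalize hE qx.
    have Kax : K (a *: x) by exact: subspaceZ.
    have [//|hlt] := leP (q (p x)) _; exfalso; apply: h; exists (a *: x);
      split => //.
    rewrite (proj_qZ hE sH (csub_sub (eigen_csub s1)) pW pO a hHx).
    have a2 : 0 < a ^+ 2 by rewrite exprn_gt0.
    move: ha; rewrite !ipE mulrA -expr2 => ha.
    by move: hlt; rewrite -(ltr_pM2l a2) mulrCA ha mulr1.
  have Ku n : K (u n) by case: (hu n).
  have qu n : q (u n) = 1 by case: (hu n).
  have Hu n := KH (Ku n).
  have d0 : q (p (u n) - u n) @[n --> \oo] --> (0 : R).
    apply: (@cvg0_le_const _ _ 1) => n; rewrite ip_ge0//= mul1r qB//.
    have := pyth (Hu n); rewrite qu; have [_ _] := hu n.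
    by move: (n.+1%:R^-1) => a; lra.
  have [|k hk [y hy]] := cS (u := p \o u) (fun n => proj1 (pW (Hu n))).
    exists 1 => n /=; have := pyth (Hu n); rewrite qu.
    by have := ip_ge0 hE (u n - p (u n)); lra.
  have hpu : converges ip (fun n => s1 *: p (u (k n))) y.
    apply: (cv_near hE hy).
    rewrite (_ : (fun n => _) = cst 0); first exact: cvg_cst.
    by apply/funext => n /=; case: (pW (Hu (k n))).
  have {hpu} hpu : converges ip (fun n => p (u (k n))) (s1^-1 *: y).
    have := cv_scale hE s1^-1 hpu; congr converges.
    by apply/funext => n; rewrite scalerA mulVf// scale1r.
  have huk : converges ip (u \o k) (s1^-1 *: y).
    by apply: (cv_near hE hpu); exact: cvg_comp (homo_cvgy hk) d0.
  have hqy := cv_q hE huk.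
  have : q (s1^-1 *: y) = 0.
    apply: KW.
      by apply: csub_closed hK _ _ _ huk => n; exact: Ku.
    by apply: csub_closed (eigen_csub s1) _ _ _ hpu => n; exact: pW.
  have -> : q (s1^-1 *: y) = 1.
    move: hqy; rewrite (_ : (fun n => _) = cst 1).
      by move=> /(cvg_lim (@Rhausdorff R)) <-; rewrite lim_cst.
    by apply/funext => n /=; rewrite qu.
  by apply/eqP; rewrite oner_eq0.
(* With s1 = 0 compactness says nothing on W, and a sequence in K approaching W need not have a
   convergent subsequence. The argument moves to the complement H' of W in H, where S is bounded
   below by [Sbelow]. *)
pose H' := H `&` orth ip W; pose Q x := x - p x.
have QH x : H x -> H' (Q x).
  by move=> hx; split; [apply: subspaceB => //; case: (pW hx)|exact: pO].
have hH' : closed_subspace ip H' by apply: setI_csub => //; exact: orth_csub.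
have s20 : 0 < s2 ^+ 2 by rewrite exprn_even_gt0//= lt_eqF// -s10.
have Sbelow x : H' x -> q x <= (s2 ^+ 2)^-1 * q (S x).
  move=> [hx ox]; rewrite ler_pdivlMl//.
  have [->|qx] := eqVneq (q x) 0; first by rewrite mulr0 ip_ge0.
  have qp : 0 < q x by rewrite lt_neqAle eq_sym qx ip_ge0.
  have := gap_orth hx ox; have := cauchy_schwarz hE (S x) x.
  move=> h1 h2; rewrite -(ler_pM2r qp); apply: le_trans h1.
  have h3 : s2 * q x <= 0 by rewrite nmulr_rle0 ?ltW// -s10.
  rewrite -mulrA -expr2 -exprMn -subr_ge0 subr_sqr mulr_le0//;
    first by rewrite subr_le0.
  by rewrite -(addr0 0) lerD// (le_trans h2).
have /choice [pK hpK] : forall x, exists y, K y /\ orth ip K (x - y).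
  by move=> x; have [y ? ?] := projection hE x hK; exists y.
(* The compression of Q to K, with <A x, x> = |Q x|^2. The goal d |x|^2 <= |Q x|^2 thus has the
   shape of the conclusion of [bounded_below], whose hypothesis is d |Q x|^2 <= |A x|^2. *)
pose A x := pK (Q x).
have AQ x y : K x -> K y -> ip (A x) y = ip (Q x) y.
  move=> hx hy; have [_ /(_ _ hy)] := hpK (Q x); rewrite -/(A x).
  by move: (Q x) (A x) => z t; rewrite !ipE => /eqP; rewrite subr_eq0 => /eqP.
have AQQ x y : K x -> K y -> ip (A x) y = ip (Q x) (Q y).
  move=> hx hy; rewrite AQ// /Q (ipDr hE y) (ipNr hE (p y)).
  by rewrite (pO (KH hx) (pW (KH hy))) subr0.
have qQ x : K x -> q (Q x) <= q x.
  by move=> hx; rewrite (pyth (KH hx)) lerDr ip_ge0.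
have KA x : K (A x) by case: (hpK (Q x)).
have qA x : q (A x) <= q (Q x).
  have [hy /(_ _ hy)] := hpK (Q x); rewrite -/(A x).
  move: (Q x) (A x) => y z; have := ip_ge0 hE (y - z).
  by rewrite !ipE (ipC hE z y); lra.
have hA : symmetric_on ip K A.
  split=> [x hx//|x y hx hy|]; first by rewrite (ipC hE x) !AQQ// ipC.
  by exists 1 => x hx; rewrite mul1r (le_trans (qA x))// qQ.
have [d d0 hd] : exists2 d, 0 < d & forall x, K x -> d * q (Q x) <= q (A x).
  apply: contrapT => hn.
  have /choice [u hu] : forall n, exists x, K x /\ q (A x) < n.+1%:R^-1 * q (Q x).
    move=> n; apply: contrapT => h; apply: hn; exists n.+1%:R^-1 => [|x hx].
      by rewrite invr_gt0.
    by have [//|hlt] := leP _ (q (A x)); exfalso; apply: h; exists x.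
  have Ku n : K (u n) by case: (hu n).
  have Hu n := KH (Ku n).
  have /choice [a ha] : forall n, exists a, q (a *: Q (u n)) = 1.
    move=> n; have [|a _ ha] := @normalize _ _ _ hE (Q (u n)); last by exists a.
    apply/eqP => qn; have [_] := hu n; rewrite qn mulr0 ltNge ip_ge0//.
  pose v n := a n *: Q (u n).
  have H'v n : H' (v n) by apply: subspaceZ (QH _ (Hu n)); exact: csub_sub hH'.
  have [|k hk [y hy]] := cS (u := v) (fun n => proj1 (H'v n)).
    by exists 1 => n; rewrite ha.
  have [||h hh] := complete_from hE (u := S \o v \o k) (v := v \o k) (c :=
    (s2 ^+ 2)^-1) _ _ hy.
  - by rewrite invr_gt0.
  - move=> m n /=.
    rewrite -(null_q hE (sym_subq hE sH hS (proj1 (H'v (k m)))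
      (proj1 (H'v (k n))))).
    by apply: Sbelow; apply: subspaceB => //; exact: csub_sub hH'.
  have [Hh oh] : H' h by apply: csub_closed hH' _ _ _ hh => n; exact: H'v.
  have qh : q h = 1.
    have := cv_q hE hh; rewrite (_ : (fun n => _) = cst 1).
      by move=> /(cvg_lim (@Rhausdorff R)) <-; rewrite lim_cst.
    by apply/funext => n /=; rewrite ha.
  have [Kh ohK] := hpK h.
  have w0 : converges ip (fun n => a n *: A (u n)) 0.
    apply: (@cvg0_le_const _ _ 1) => n; rewrite subr0 ip_ge0//= mul1r.
    rewrite (ipZl hE) (ipZr hE) mulrA -expr2; have [_ hn2] := hu n.
    have := ha n; rewrite (ipZl hE) (ipZr hE) mulrA -expr2 => h1.
    rewrite -[leRHS]mulr1 -[X in _ <= _ * X]h1 mulrCA; apply: ler_wpM2l;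
      [exact: sqr_ge0|exact: ltW].
  have qKh : q (pK h) = 0.
    have -> : q (pK h) = ip h (pK h).
      by have := ohK _ Kh; rewrite !ipE => /eqP; rewrite subr_eq0 => /eqP.
    have := cv_ip (y := pK h) hE hh.
    rewrite (_ : (fun n => _) = (fun n => ip (a (k n) *: A (u (k n))) (pK h))).
      have := cv_ip (y := pK h) hE (cv_subseq hk w0).
      by move=> /(cvg_lim (@Rhausdorff R)) + /(cvg_lim (@Rhausdorff R)) <-;
        rewrite ip0l.
    by apply/funext => n /=; rewrite !(ipZl hE) AQ.
  (* The limit h is orthogonal to W, hence to p (u (k n)), and orthogonal to K, hence to u (k n). So
     every v (k n) is orthogonal to its own limit. *)
  have : q h = 0.
    have := cv_ip (y := h) hE hh.
    rewrite (_ : (fun n => _) = cst 0).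
      by move=> /(cvg_lim (@Rhausdorff R)) <-; rewrite lim_cst.
    apply/funext => n /=; rewrite (ipZl hE) /Q (ipDl hE) (ipNl hE).
    rewrite (ipC hE (p _)) oh ?subr0; last exact: pW.
    have : ip (h - pK h) (u (k n)) = 0 by exact: ohK.
    rewrite (ipDl hE) (ipNl hE) (null_ip hE _ qKh) subr0 (ipC hE) => ->.
    by rewrite mulr0.
  by rewrite qh; apply/eqP; rewrite oner_eq0.
have hb := bounded_below hE hK hA _ _ (ltW d0).
exists (1 - d) => [|x hx]; first by rewrite ltrBlDr ltrDl.
suff : d * q x <= ip (A x) x.
  by rewrite AQQ// (pyth (KH hx)) -/(Q x); lra.
apply: hb => // y hy.
- by rewrite AQQ// ip_ge0.
- move=> qAy; have qQy : q (y - p y) = 0.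
    have := hd y hy; rewrite qAy pmulr_rle0// => h.
    by apply/eqP; rewrite eq_le h ip_ge0.
  apply: KW => //; apply: (closed_subspace_null (eigen_csub s1) (pW (KH hy))).
  by rewrite qB.
- by rewrite AQQ// hd.
Qed.

End Gap.

(** * The symmetric part of a compact contraction *)

Section SymmetricPart.
Context (R : realType) (E : lmodType R) (ip : E -> E -> R).
Hypothesis hE : semi_hilbert ip.
Implicit Types (x y z : E) (u v : nat -> E).
Local Notation q x := (ip x x).
Local Notation ipE := (ipE hE).
Context (P : E -> E).
Hypothesis P_lin : forall a x y z,
  ip (P (a *: x + y)) z = a * ip (P x) z + ip (P y) z.
Hypothesis P_contr : forall x, q (P x) <= q x.

Lemma adjoint_exists : exists Q : E -> E, forall x y, ip (P x) y = ip x (Q y).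
Proof.
suff /choice : forall y, exists h, forall x, ip (P x) y = ip x h.
  by move=> [Q hQ]; exists Q.
move=> y; apply: (riesz hE (C := q y)) => [a x z|x]; first exact: P_lin.
apply: (le_trans (cauchy_schwarz hE _ _)).
by rewrite mulrC ler_wpM2l ?ip_ge0.
Qed.

Lemma P_subq x y : q (P (x - y) - (P x - P y)) = 0.
Proof.
have h z : ip (P (x - y)) z = ip (P x - P y) z.
  by rewrite addrC -scaleN1r P_lin !ipE; ring.
by rewrite ipDl// ipNl// h -ipNl// -ipDl// subrr ip0l.
Qed.

Context (S : E -> E).
Hypothesis S_ip : forall x y, ip (S x) y = (ip (P x) y + ip x (P y)) / 2.

Lemma symmetric_part_sym : symmetric_on ip [set: E] S.
Proof.
split=> // [x y _ _|]; first by rewrite (ipC hE x (S y)) !S_ip (ipC hE x)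
  (ipC hE y) addrC.
exists 1 => x _; rewrite mul1r.
have c1 := cauchy_schwarz hE (P x) (S x).
have c2 := cauchy_schwarz hE x (P (S x)).
have h1 := P_contr x; have h2 := P_contr (S x).
have hx := ip_ge0 hE x; have hs := ip_ge0 hE (S x).
have b1 : ip (P x) (S x) ^+ 2 <= q x * q (S x) by apply: (le_trans c1);
  rewrite ler_wpM2r.
have b2 : ip x (P (S x)) ^+ 2 <= q x * q (S x) by apply: (le_trans c2);
  rewrite ler_wpM2l.
have := S_ip x (S x).
move: (ip (P x) _) (ip x (P _)) b1 b2 => a b b1 b2 e.
have [s0|sn] := eqVneq (q (S x)) 0; first by rewrite s0.
have sp : 0 < q (S x) by rewrite lt_neqAle eq_sym sn.
(* The square of (a + b) / 2 is at most (a^2 + b^2) / 2, and a^2 and b^2 are both bounded by q x * q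
   (S x). *)
rewrite -(ler_pM2r sp) -expr2 e; have := sqr_ge0 (a - b); nra.
Qed.

(** The point is compactness of the adjoint Q. Since Q u is bounded, P Q u converges along a
    subsequence; and |Q a - Q b|^2 = <P (Q a - Q b), a - b> then makes Q u Cauchy along it. *)
Lemma symmetric_part_compact : compact_on ip [set: E] P -> compact_on ip [set: E] S.
Proof.
move=> cP u _ [B hB].
have [Q hQ] := adjoint_exists.
have Q_contr y : q (Q y) <= q y.
  have := cauchy_schwarz hE (P (Q y)) y; rewrite hQ => h.
  have [->|qn] := eqVneq (q (Q y)) 0; first exact: ip_ge0.
  have qp : 0 < q (Q y) by rewrite lt_neqAle eq_sym qn ip_ge0.
  rewrite -(ler_pM2l qp) -expr2 (le_trans h)// ler_wpM2r ?ip_ge0//.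
have [k1 hk1 [y1 hy1]] := cP u (fun _ => I) (ex_intro _ B hB).
have [|k2 hk2 [y2 hy2]] := cP (Q \o u \o k1) (fun _ => I).
  by exists B => n; apply: le_trans (Q_contr _) (hB _).
pose v := u \o k1 \o k2.
have B0 : 0 < `|B| + 1 by rewrite ltr_wpDl.
have [|y3 hy3] := ip_complete hE (u := Q \o v).
  move=> e e0.
  (* The factor 4 (|B| + 1) exceeds q (a - b) for any two terms a, b of the sequence; the added 1
     keeps it positive. *)
  have [|N hN] := cv_cauchy hE hy2 (e := e ^+ 2 / (4 * (`|B| + 1))).
    by rewrite divr_gt0 ?exprn_gt0 ?mulr_gt0.
  exists N => m n hm hn; rewrite -ltr_sqr ?nnegrE ?ip_ge0 ?(ltW e0)//.
  have := hN m n hm hn; rewrite ltr_pdivlMr ?mulr_gt0//= => hPQ.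
  apply: le_lt_trans hPQ.
  set a := v m; set b := v n; rewrite -[u (k1 (k2 m))]/a -[u (k1 (k2 n))]/b.
  have -> : q (Q a - Q b) = ip (P (Q a - Q b)) (a - b).
    by rewrite (ipDr hE a) (ipNr hE b) !hQ -(ipNr hE (Q b)) -(ipDr hE (Q a)).
  apply: (le_trans (cauchy_schwarz hE _ _)).
  rewrite (null_q hE (P_subq (Q a) (Q b))) ler_wpM2l ?ip_ge0//.
  have := q_add hE a (- b); have := hB (k1 (k2 m)); have := hB (k1 (k2 n)).
  rewrite -[u (k1 (k2 m))]/a -[u (k1 (k2 n))]/b.
  have := ler_norm B; rewrite (ipNl hE b) (ipNr hE b) opprK; lra.
exists (k1 \o k2); first by move=> m n h; apply: hk1; exact: hk2.
exists (2^-1 *: (y1 + y3)).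
have h := cv_scale hE 2^-1 (cv_add hE (cv_subseq hk2 hy1) hy3).
apply: (cv_near hE h).
rewrite (_ : (fun n => _) = cst 0); first exact: cvg_cst.
apply/funext => n /=; set x := u _.
have hz z : ip (2^-1 *: (P x + Q x)) z = ip (S x) z.
  by rewrite S_ip (ipC hE x) (hQ z x) !ipE (ipC hE z); field.
by rewrite ipDl// ipNl// hz subrr.
Qed.

End SymmetricPart.

(** * The space of square-integrable functions *)

Section L2Space.
Context (R : realType) d (X : measurableType d) (pi : probability X R).
Implicit Types f h : X -> R.

Lemma L2P f : L2 pi f <->
  measurable_fun [set: X] f /\ (\int[pi]_x ((f x ^+ 2)%:E) < +oo)%E.
Proof.
split=> [hf|[mf hf]].
  split; last by apply: integrable_lty => //; exact: Lfun2_integrable_sqr.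
  by move: hf; rewrite /L2/= inE => /andP[mf _]; move: mf; rewrite inE.
rewrite /L2/= inE; apply/andP; split; rewrite inE//=.
rewrite /finite_norm unlock /Lnorm poweR_lty//=.
by under eq_integral => x _ do rewrite powR_mulrn// real_normK ?num_real//.
Qed.

Lemma L2_measurable f : L2 pi f -> measurable_fun [set: X] f.
Proof. by move=> /L2P[]. Qed.

Lemma L2_mul_integrable f h : L2 pi f -> L2 pi h ->
  pi.-integrable [set: X] (EFin \o (fun x => f x * h x)).
Proof. by move=> hf hh; apply/Lfun1_integrable/Lfun2_mul_Lfun1. Qed.

Lemma L2_integrable f : L2 pi f -> pi.-integrable [set: X] (EFin \o f).
Proof.
by move=> hf; apply/Lfun1_integrable; apply: Lfun_subset12 hf;
  exact: fin_num_measure.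
Qed.

Lemma L2_cst c : L2 pi (cst c).
Proof. exact: Lfun_cst. Qed.

Lemma one_le2e : (1 <= 2%:E :> \bar R)%E.
Proof. by rewrite lee1n. Qed.

Lemma L2_sub_submod : subspace (L2 pi : set (X -> R)).
Proof.
split; first exact: L2_cst.
move=> a f h hf hh; have [_ /(_ a f h)] :=
  @Lfun_submod_closed _ X R pi 2%:E one_le2e.
exact.
Qed.

Lemma L2_innerE f : L2 pi f -> (L2_inner pi f f)%:E = (\int[pi]_x ((f x ^+
  2)%:E))%E.
Proof.
move=> hf; rewrite /L2_inner /Rintegral fineK.
  by apply: eq_integral => x _; rewrite expr2.
by apply: integrable_fin_num => //; exact: L2_mul_integrable.
Qed.

Lemma L2_inner_ge0 f : 0 <= L2_inner pi f f.
Proof. by apply: Rintegral_ge0 => x _; rewrite -expr2 sqr_ge0. Qed.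

Lemma L2_innerC f h : L2_inner pi f h = L2_inner pi h f.
Proof. by apply: eq_Rintegral => x _; rewrite mulrC. Qed.

Lemma L2_innerD f g h : L2 pi f -> L2 pi g -> L2 pi h ->
  L2_inner pi (f + g) h = L2_inner pi f h + L2_inner pi g h.
Proof.
move=> hf hg hh; rewrite -RintegralD//; try exact: L2_mul_integrable.
by apply: eq_Rintegral => x _; rewrite mulrDl.
Qed.

Lemma L2_innerZ a f h : L2 pi f -> L2 pi h ->
  L2_inner pi (a *: f) h = a * L2_inner pi f h.
Proof.
move=> hf hh; rewrite -RintegralZl//; last exact: L2_mul_integrable.
by apply: eq_Rintegral => x _; rewrite -mulrA.
Qed.

Lemma L2_innerB f g h : L2 pi f -> L2 pi g -> L2 pi h ->
  L2_inner pi (f - g) h = L2_inner pi f h - L2_inner pi g h.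
Proof.
move=> hf hg hh; rewrite -RintegralB//; try exact: L2_mul_integrable.
by apply: eq_Rintegral => x _; rewrite mulrBl.
Qed.

Lemma ae_L2_inner f g h : L2 pi f -> L2 pi g -> L2 pi h ->
  f = g %[ae pi] -> L2_inner pi f h = L2_inner pi g h.
Proof.
move=> hf hg hh fg; congr fine; apply: ae_eq_integral => //.
- by case/integrableP: (L2_mul_integrable hf hh).
- by case/integrableP: (L2_mul_integrable hg hh).
- by apply: filterS fg => x /= /[apply] ->.
Qed.

Lemma L2_inner_eq0 f : L2 pi f -> L2_inner pi f f = 0 <-> f = cst 0 %[ae pi].
Proof.
move=> hf; split => [h0|f0]; last first.
  rewrite (ae_L2_inner hf (L2_cst 0) hf f0) /L2_inner.
  by under eq_Rintegral do rewrite /= mul0r; rewrite Rintegral_cst// mul0r.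
have mf := L2_measurable hf.
have : (\int[pi]_x `|(f x ^+ 2)%:E|)%E = 0%E.
  rewrite -[RHS]/(0%:E) -h0 L2_innerE//; apply: eq_integral => x _.
  by rewrite gee0_abs// lee_fin sqr_ge0.
move/ae_eq_integral_abs => /(_ measurableT).
have mf2 : measurable_fun [set: X] (fun x => (f x ^+ 2)%:E : \bar R).
  by apply/measurable_EFinP; exact: measurable_funX.
move=> /(_ mf2); apply: filterS => x /= h xT.
by have /eqP := h xT; rewrite eqe sqrf_eq0 => /eqP.
Qed.

End L2Space.

(** * Completeness of the space of square-integrable functions *)

Section Completeness.
Context (R : realType) d (X : measurableType d) (pi : probability X R).
Implicit Types (f h : X -> R) (u : nat -> X -> R).

Lemma L2B f h : L2 pi f -> L2 pi h -> L2 pi (f - h).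
Proof. by move=> hf hh; exact: subspaceB (L2_sub_submod pi) hf hh. Qed.

(** The increments have integrals at most 2^-n in absolute value, so the sum of their absolute
    values is integrable, hence finite almost everywhere. *)
Lemma fast_cauchy_ae_cvg u : (forall n, L2 pi (u n)) ->
  (forall n, L2_inner pi (u n.+1 - u n) (u n.+1 - u n) <= 4^-1 ^+ n) ->
  {ae pi, forall x, cvgn (u ^~ x)}.
Proof.
move=> hu hq.
pose h n x := `|u n.+1 x - u n x|.
have mh n : measurable_fun [set: X] (h n).
  by apply: measurableT_comp => //; apply: measurable_funB; exact: L2_measurable.
have h0 n x : 0 <= h n x by exact: normr_ge0.
have ih n : (\int[pi]_x (h n x)%:E <= (2^-1 ^+ n)%:E)%E.
  have hd := L2B (hu n.+1) (hu n).
  have id := L2_mul_integrable hd hd.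
  (* As 4 a b = 1, t <= a t^2 + b for every t; the scaling makes the integral of a t^2 at most 2^-n
     / 2, which equals b. *)
  pose a : R := 2 ^+ n / 2; pose b : R := 2^-1 ^+ n / 2.
  have i1 : pi.-integrable [set: X] (EFin \o (fun x => a * ((u n.+1 - u n)
    x * (u n.+1 - u n) x))).
    by have := integrableZl measurableT a id; apply: eq_integrable.
  have i2 : pi.-integrable [set: X] (EFin \o (cst b : X -> R)).
    exact: L2_integrable (L2_cst pi b).
  have : (\int[pi]_x (h n x)%:E <= \int[pi]_x (a * ((u n.+1 - u n)
    x * (u n.+1 - u n) x) + b)%:E)%E.
    apply: ge0_le_integral => //.
    - by move=> x _; rewrite lee_fin.
    - exact/measurable_EFinP.
    - apply/measurable_EFinP; apply: measurable_funD => //.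
      by case/integrableP: i1 => /measurable_EFinP.
    - move=> x _; rewrite lee_fin /h -[(u n.+1 - u n) x]/(u n.+1 x - u n x).
      move: (u n.+1 x - u n x) => t; rewrite -expr2 -real_normK ?num_real//.
      move: `|t| => {}t; rewrite /a /b.
      have p0 : 0 < 2 ^+ n :> R by rewrite exprn_gt0.
      have p1 : 2 ^+ n * 2^-1 ^+ n = 1 :> R by rewrite -exprMn divff// expr1n.
      move: (2 ^+ n) (2^-1 ^+ n) p0 p1 => p q p0 pq.
      have q0 : 0 <= q by rewrite -(pmulr_rge0 _ p0) pq.
      have := mulr_ge0 q0 (sqr_ge0 (p * t - 1)).
      have -> : q * (p * t - 1) ^+ 2 = (p * q) * (p * t ^+ 2) - 2 * (p * q)
        * t + q by ring.
      by rewrite pq; lra.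
  move=> /le_trans; apply; rewrite integralD_EFin//.
  have -> : (\int[pi]_x (a * ((u n.+1 - u n) x * (u n.+1 - u n) x))%:E)%E =
      (a%:E * \int[pi]_x ((u n.+1 - u n) x * (u n.+1 - u n) x)%:E)%E.
    by rewrite -integralZl//; apply: eq_integral => x _; rewrite -EFinM.
  rewrite integral_cst// [X in (_ + _ * X)%E](_ : _ = 1%E) ?mule1;
    last exact: probability_setT.
  have -> : (\int[pi]_x ((u n.+1 - u n) x * (u n.+1 - u n) x)%:E)%E =
      (L2_inner pi (u n.+1 - u n) (u n.+1 - u n))%:E.
    by rewrite fineK//; exact: integrable_fin_num.
  rewrite -EFinM -EFinD lee_fin /a /b.
  have p0 : 0 < 2 ^+ n :> R by rewrite exprn_gt0.
  have p1 : 2 ^+ n * 2^-1 ^+ n = 1 :> R by rewrite -exprMn divff// expr1n.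
  have := hq n; have -> : 4^-1 = 2^-1 * 2^-1 :> R by rewrite -invfM;
    congr (_^-1); ring.
  rewrite exprMn.
  move: (2 ^+ n) (2^-1 ^+ n) p0 p1 (L2_inner _ _ _) => p q p0 pq t ht.
  have := ler_wpM2l (ltW p0) ht; rewrite mulrA pq; lra.
have sfin : (\int[pi]_x (\sum_(n <oo) (h n x)%:E) < +oo)%E.
  rewrite integral_nneseries//; last 2 first.
  - by move=> n; exact/measurable_EFinP.
  - by move=> n x _; rewrite lee_fin.
  have geo n : \sum_(0 <= i < n) 2^-1 ^+ i = 2 - 2 * 2^-1 ^+ n :> R.
    elim: n => [|n ihn]; first by rewrite big_nil expr0; ring.
    by rewrite big_nat_recr//= ihn exprS; field.
  apply: (@le_lt_trans _ _ 2%:E); last exact: ltry.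
  apply: lime_le.
    by apply: is_cvg_nneseries => n _ _; apply: integral_ge0 => x _;
      rewrite lee_fin.
  near=> n; apply: (@le_trans _ _ (\sum_(0 <= i < n) (2^-1 ^+ i)%:E)%E).
    by apply: lee_sum => i _; exact: ih.
  rewrite sumEFin lee_fin.
  rewrite geo.
  by rewrite gerBl mulr_ge0// exprn_ge0.
have : {ae pi, forall x, [set: X] x -> (\sum_(n <oo) (h n x)%:E)%E \is a fin_num}.
  apply: integrable_ae => //; apply/integrableP; split.
    by apply: ge0_emeasurable_sum => n *; [rewrite lee_fin|exact/measurable_EFinP].
  rewrite (eq_integral (fun x => \sum_(n <oo) (h n x)%:E)%E)// => x _.
  by rewrite gee0_abs//; apply: nneseries_ge0 => n _ _; rewrite lee_fin.
apply: filterS => x /= /(_ I) hx.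
suff : cvgn (series (telescope (u ^~ x))).
  rewrite telescopeK => hc.
  have -> : u ^~ x = (fun n => (u n x - u 0%N x) + u 0%N x).
    by apply/funext => n; rewrite subrK.
  by apply: is_cvgD => //; exact: is_cvg_cst.
apply: normed_cvg; apply: nondecreasing_is_cvgn.
  by apply: nondecreasing_series => i _ _; exact: normr_ge0.
exists (fine (\sum_(n <oo) (h n x)%:E)%E) => _ [n _ <-].
rewrite -lee_fin fineK// -sumEFin; apply: nneseries_lim_ge => i _ _.
by rewrite lee_fin normr_ge0.
Unshelve. all: end_near. Qed.

End Completeness.

Section CompletenessFatou.
Context (R : realType) d (X : measurableType d) (pi : probability X R).
Implicit Types (f h : X -> R) (u : nat -> X -> R).

(** The upper limit is measurable with no convergence assumption and equals the limit wherever that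
    exists. *)
Let ae_lim u x : R := fine (limn_esup (fun n => (u n x)%:E)).

Let measurable_ae_lim u : (forall n, L2 pi (u n)) ->
  measurable_fun [set: X] (ae_lim u).
Proof.
move=> hu; apply: measurableT_comp => //; apply: measurable_fun_limn_esup => n.
by apply/measurable_EFinP; exact: L2_measurable.
Qed.

Let cvg_ae_lim u x : cvgn (u ^~ x) -> u ^~ x @ \oo --> ae_lim u x.
Proof.
move=> /cvg_ex[l hl]; rewrite /ae_lim.
have h : (fun n => (u n x)%:E) @ \oo --> l%:E by apply: cvg_EFin => //;
  exact: nearW.
by rewrite (cvg_limn_einf_sup h).2.
Qed.

(** Fatou for the sequence shifted by [j0], since the bound is known only from that index on and the
    limit does not see the shift. *)
Let L2_fatou f u c j0 : L2 pi f -> (forall n, L2 pi (u n)) ->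
  {ae pi, forall x, cvgn (u ^~ x)} ->
  (forall j, (j0 <= j)%N -> L2_inner pi (f - u j) (f - u j) <= c) ->
  (\int[pi]_x ((f x - ae_lim u x) ^+ 2)%:E <= c%:E)%E.
Proof.
move=> hf hu hcv hq.
pose F j x := ((f x - u (j + j0)%N x) ^+ 2)%:E.
have mF j : measurable_fun [set: X] (F j).
  apply/measurable_EFinP; apply: measurable_funX; apply: measurable_funB.
    exact: L2_measurable hf.
  exact: L2_measurable (hu _).
have F0 j x : [set: X] x -> (0 <= F j x)%E by move=> _; rewrite lee_fin sqr_ge0.
apply: (@le_trans _ _ (\int[pi]_x limn_einf (F ^~ x))%E).
  apply: ae_ge0_le_integral => //.
  - by move=> x _; rewrite lee_fin sqr_ge0.
  - apply/measurable_EFinP; apply: measurable_funX; apply: measurable_funB.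
      exact: L2_measurable hf.
    exact: measurable_ae_lim.
  - move=> x _; rewrite limn_einf_lim; apply: lime_ge; first exact: is_cvg_einfs.
    by apply: nearW => n; apply: le_ereal_inf_tmp => _ [m _ <-]; exact: F0.
  - rewrite /limn_einf; apply: measurableT_comp => //.
    apply: measurable_fun_limn_esup => n; exact: measurableT_comp.
  - apply: filterS hcv => x /cvg_ae_lim hx _.
    suff h : F ^~ x @ \oo --> ((f x - ae_lim u x) ^+ 2)%:E.
      by rewrite (cvg_limn_einf_sup h).1.
    apply: cvg_EFin; first exact: nearW.
    have hs : (fun j => u (j + j0)%N x) @ \oo --> ae_lim u x.
      by have := hx; rewrite -(cvg_shiftn j0).
    have hB : (fun j => f x - u (j + j0)%N x) @ \oo --> f x - ae_lim u x.
      by apply: cvgB => //; exact: cvg_cst.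
    have -> : fine \o F ^~ x = (fun j => (f x - u (j + j0)%N x)
      * (f x - u (j + j0)%N x)).
      by apply/funext => j /=; rewrite -expr2.
    by rewrite expr2; exact: cvgM.
apply: (le_trans (fatou pi measurableT mF F0)).
rewrite limn_einf_lim; apply: lime_le; first exact: is_cvg_einfs.
apply: nearW => n; apply: ge_ereal_inf.
exists (\int[pi]_x F n x)%E; first by exists n => /=.
have hd := L2B hf (hu (n + j0)%N).
by rewrite -L2_innerE// lee_fin hq// leq_addl.
Qed.

(** Riesz-Fischer. Fatou along a fast subsequence bounds u m - g for all large m of the whole
    sequence, which yields both that g is square-integrable and that the whole sequence converges to
    it. *)
Lemma L2_complete u : (forall n, L2 pi (u n)) ->
  (forall e, 0 < e -> exists N, forall m n, (N <= m)%N -> (N <= n)%N ->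
     L2_inner pi (u m - u n) (u m - u n) < e) ->
  exists2 g, L2 pi g & L2_inner pi (u n - g) (u n - g) @[n --> \oo] --> (0 : R).
Proof.
move=> hu hc.
have /choice [N hN] : forall j, exists N, forall m n, (N <= m)%N -> (N <= n)%N ->
    L2_inner pi (u m - u n) (u m - u n) < 4^-1 ^+ j.
  by move=> j; apply: hc; rewrite exprn_gt0.
(* Partial sums dominate [N] and are monotone, which [N] itself need not be. *)
pose k j := (\sum_(i < j.+1) N i)%N.
have Nk j : (N j <= k j)%N by rewrite /k big_ord_recr/= leq_addl.
have kS j : (k j <= k j.+1)%N by rewrite {2}/k big_ord_recr/= leq_addr.
have kmono i j : (i <= j)%N -> (k i <= k j)%N.
  by move=> /subnK <-; elim: (j - i)%N => // n ih; exact: leq_trans ih (kS _).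
have hw n : L2 pi (u (k n)) by [].
have hcv : {ae pi, forall x, cvgn ((u \o k) ^~ x)}.
  apply: fast_cauchy_ae_cvg => // j; apply/ltW/hN => //.
  exact: leq_trans (Nk j) (kS j).
pose g := ae_lim (u \o k).
have mg : measurable_fun [set: X] g by exact: measurable_ae_lim.
have key j m : (k j <= m)%N -> (\int[pi]_x ((u m x - g x)
  ^+ 2)%:E <= (4^-1 ^+ j)%:E)%E.
  move=> hm; apply: (@L2_fatou _ _ _ j) => // i hi; apply/ltW/hN.
    exact: leq_trans (Nk j) hm.
  exact: leq_trans (Nk j) (kmono _ _ hi).
have hd j m : (k j <= m)%N -> L2 pi (u m - g).
  move=> hm; apply/L2P; split.
    by apply: measurable_funB => //; exact: L2_measurable (hu _).
  by apply: (le_lt_trans (key _ _ hm)); exact: ltry.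
have hg : L2 pi g.
  have -> : g = u (k 0%N) - (u (k 0%N) - g) by rewrite opprB addrC subrK.
  by apply: L2B => //; exact: (hd 0%N).
exists g => //.
have qle j m : (k j <= m)%N -> L2_inner pi (u m - g) (u m - g) <= 4^-1 ^+ j.
  by move=> hm; rewrite -lee_fin L2_innerE ?key//; exact: hd hm.
apply/cvgrPdist_lt => e e0.
have : 4^-1 ^+ j @[j --> \oo] --> (0 : R).
  by apply: cvg_expr; rewrite ger0_norm// invf_lt1// ltr1n.
move=> /cvgrPdist_lt/(_ _ e0)[J _ /(_ J)] /= /(_ (leqnn _)).
rewrite sub0r normrN ger0_norm ?exprn_ge0// => hJ.
exists (k J) => // m /= hm; rewrite sub0r normrN ger0_norm ?L2_inner_ge0//.
exact: le_lt_trans (qle _ _ hm) hJ.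
Qed.

End CompletenessFatou.

Section L2Hilbert.
Context (R : realType) d (X : measurableType d) (pi : probability X R).

(** Bundled functions with their vector space structure, not classes; this is why the form is only
    semi-definite. *)
Definition L2T := LfunType pi (one_le2e R).
Definition L2T_inner (f h : L2T) : R := L2_inner pi f h.

Lemma L2T_L2 (f : L2T) : L2 pi f.
Proof. exact: LfunP. Qed.

Definition toL2 f (hf : L2 pi f) : L2T := Lfun_Sub (one_le2e R) hf.

Lemma L2_semi_hilbert : semi_hilbert L2T_inner.
Proof.
split=> [x y|x y z|a x z|x|u hu]; rewrite /L2T_inner.
- exact: L2_innerC.
- by rewrite -L2_innerD//; exact: L2T_L2.
- by rewrite -L2_innerZ//; exact: L2T_L2.
- exact: L2_inner_ge0.
- have [|g hg hc] := @L2_complete _ _ _ pi u (fun n => L2T_L2 (u n));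
    first exact: hu.
  by exists (toL2 hg).
Qed.

End L2Hilbert.

(** * Markov kernels on L2 *)

Section Jensen.
Context (R : realType) d (Y : measurableType d) (nu : {measure set Y -> \bar R}).
Hypothesis nu1 : nu [set: Y] = 1%E.
Implicit Types f : Y -> R.

Let integrable_const c : nu.-integrable [set: Y] (EFin \o (cst c : Y -> R)).
Proof.
apply/integrableP; split; first exact/measurable_EFinP.
rewrite (eq_integral (cst `|c|%:E))//.
by rewrite integral_cst// nu1 mule1 ltry.
Qed.

Lemma sqr_integrable f : measurable_fun [set: Y] f ->
  (\int[nu]_y ((f y ^+ 2)%:E) < +oo)%E -> nu.-integrable [set: Y] (EFin \o f).
Proof.
move=> mf hf; apply: (@le_integrable _ _ _ _ _ measurableT _ (fun y => (f y ^+
  2)%:E + 1%:E)%E).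
- exact/measurable_EFinP.
- move=> y _; rewrite -EFinD /= lee_fin [leRHS]ger0_norm ?addr_ge0 ?sqr_ge0//.
  rewrite -real_normK ?num_real//; move: (normr_ge0 (f y)); move: `|f y| => t.
  by move=> t0; have := sqr_ge0 (t - 1); have := sqr_ge0 t; nra.
apply: integrableD => //; last exact: integrable_const.
apply/integrableP; split; first exact/measurable_EFinP/measurable_funX.
by under eq_integral do rewrite gee0_abs ?lee_fin ?sqr_ge0//.
Qed.

(** Integrate (f - m)^2 >= 0 with m the mean. If f^2 is not integrable the right-hand side is
    infinite, so no integrability is assumed. *)
Lemma jensen_sqr f : measurable_fun [set: Y] f ->
  (((\int[nu]_y f y) ^+ 2)%:E <= \int[nu]_y ((f y ^+ 2)%:E))%E.
Proof.
move=> mf; have [->|] := eqVneq (\int[nu]_y ((f y ^+ 2)%:E))%E +oo%E;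
  first exact: leey.
rewrite -ltey => hf; have int_f := sqr_integrable mf hf.
set m := (\int[nu]_y f y).
have int_f2 : nu.-integrable [set: Y] (EFin \o (fun y => f y ^+ 2)).
  apply/integrableP; split; first exact/measurable_EFinP/measurable_funX.
  by under eq_integral do rewrite gee0_abs ?lee_fin ?sqr_ge0//.
have E2 : (\int[nu]_y ((f y ^+ 2)%:E))%E = (\int[nu]_y f y ^+ 2)%:E.
  by rewrite fineK//; exact: integrable_fin_num.
rewrite E2 lee_fin.
have : 0 <= \int[nu]_y (f y ^+ 2 - (2 * m * f y - m ^+ 2)).
  apply: Rintegral_ge0 => y _; have := sqr_ge0 (f y - m); congr (_ <= _); ring.
have i1 : nu.-integrable [set: Y] (EFin \o (fun y => 2 * m * f y)).
  by have := integrableZl measurableT (2 * m) int_f; apply: eq_integrable.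
have i2 : nu.-integrable [set: Y] (EFin \o (fun y => 2 * m * f y - m ^+ 2)).
  by have := integrableB measurableT i1 (integrable_const (m ^+ 2));
    apply: eq_integrable.
rewrite RintegralB// RintegralB//; last exact: integrable_const.
rewrite (RintegralZl _ measurableT int_f).
rewrite -/m Rintegral_cst// nu1/=; lra.
Qed.

End Jensen.

Section KernelMeasurability.
Context (R : realType) d d' (T : measurableType d) (Y : measurableType d').

Lemma measurable_kernel_Rintegral (k : R.-ftker T ~> Y) (f : T * Y -> R) :
  measurable_fun [set: T * Y] f ->
  measurable_fun [set: T] (fun x => \int[k x]_y f (x, y)).
Proof.
move=> mf; apply: measurableT_comp => //.
rewrite (_ : (fun x => _) = (fun x => kfcomp k ((EFin \o f)^\+)%E x - kfcomp k
  ((EFin \o f)^\-)%E x)%E).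
  apply: emeasurable_funB; apply: measurable_kfcomp => //.
  - by apply: measurable_funepos; exact/measurable_EFinP.
  - by apply: measurable_funeneg; exact/measurable_EFinP.
apply/funext => x; rewrite integralE /kfcomp.
by congr (_ - _)%E; apply: eq_integral => y _; rewrite ?funeposE ?funenegE.
Qed.

End KernelMeasurability.

Section Stationary.
Context (R : realType) d (X : measurableType d) (pi : probability X R).
Context (P : R.-pker X ~> X).
Hypothesis hP : stationary pi P.
Implicit Types f : X -> R.

(** With pi regarded as a constant kernel, the left side is an integral against the composition of
    pi and P, and stationarity identifies that measure with pi on measurable sets. *)
Lemma ge0_stationary (f : X -> \bar R) : measurable_fun [set: X] f ->
  (forall x, 0 <= f x)%E -> (\int[pi]_x \int[P x]_y f y = \int[pi]_y f y)%E.
Proof.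
move=> mf f0.
pose l := @kprobability _ _ X X R (cst pi) (@measurable_cst _ _ _ _ _ _).
pose k := @kernel.kernel_snd _ _ _ X X X R P.
transitivity (\int[kcomp l k point]_y f y)%E; first by rewrite integral_kcomp.
by apply: eq_measure_integral => A mA _; rewrite -hP.
Qed.

Lemma kernel_mass x : P x [set: X] = 1%E.
Proof. exact: prob_kernel. Qed.

Lemma measurable_kernel_op f : measurable_fun [set: X] f ->
  measurable_fun [set: X] (kernel_op P f).
Proof.
move=> mf.
exact: (measurable_kernel_Rintegral P (f :=
  f \o snd) (measurableT_comp mf measurable_snd)).
Qed.

Lemma kernel_op_sqr_le f : L2 pi f ->
  (\int[pi]_x ((kernel_op P f x ^+ 2)%:E) <= \int[pi]_x ((f x ^+ 2)%:E))%E.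
Proof.
move=> /L2P[mf hf].
have mf2 : measurable_fun [set: X] (fun x => (f x ^+ 2)%:E).
  exact/measurable_EFinP/measurable_funX.
rewrite -(ge0_stationary mf2); last by move=> x; rewrite lee_fin sqr_ge0.
apply: ge0_le_integral => //.
- by move=> x _; rewrite lee_fin sqr_ge0.
- exact/measurable_EFinP/measurable_funX/measurable_kernel_op.
- apply: measurable_fun_integral_kernel => //.
  + by move=> U mU; exact: measurable_kernel.
  + by move=> x; rewrite lee_fin sqr_ge0.
- by move=> x _; apply: jensen_sqr => //; exact: kernel_mass.
Qed.

Lemma L2_kernel_op f : L2 pi f -> L2 pi (kernel_op P f).
Proof.
move=> hf; apply/L2P; split; first exact: measurable_kernel_op (L2_measurable hf).
by apply: (le_lt_trans (kernel_op_sqr_le hf)); case/L2P: hf.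
Qed.

Lemma kernel_op_contraction f : L2 pi f ->
  L2_inner pi (kernel_op P f) (kernel_op P f) <= L2_inner pi f f.
Proof.
by move=> hf; have hPf := L2_kernel_op hf;
  rewrite -lee_fin !L2_innerE// kernel_op_sqr_le.
Qed.

(** P applied to f^2 has a finite pi-integral, so it is finite almost everywhere. Elsewhere
    [kernel_op] may take default values, so its linearity is claimed only almost everywhere. *)
Lemma ae_kernel_integrable f : L2 pi f ->
  {ae pi, forall x, (P x).-integrable [set: X] (EFin \o f)}.
Proof.
move=> /L2P[mf hf].
have mf2 : measurable_fun [set: X] (fun x => (f x ^+ 2)%:E).
  exact/measurable_EFinP/measurable_funX.
have f20 x : (0 <= (f x ^+ 2)%:E)%E by rewrite lee_fin sqr_ge0.
have mI : measurable_fun [set: X] (fun x => \int[P x]_y ((f y ^+ 2)%:E))%E.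
  by apply: measurable_fun_integral_kernel => // U mU; exact: measurable_kernel.
have : {ae pi, forall x, [set: X] x ->
  (\int[P x]_y ((f y ^+ 2)%:E))%E \is a fin_num}.
  apply: integrable_ae => //; apply/integrableP; split=> //.
  under eq_integral do rewrite gee0_abs ?integral_ge0//.
  by rewrite ge0_stationary.
apply: filterS => x /= /(_ I) hx; apply: sqr_integrable => //;
  first exact: kernel_mass.
by rewrite ltey_eq hx.
Qed.

Lemma kernel_op_linear a f g : L2 pi f -> L2 pi g ->
  kernel_op P (a *: f + g) = a *: kernel_op P f + kernel_op P g %[ae pi].
Proof.
move=> hf hg; apply: filterS2 (ae_kernel_integrable hf) (ae_kernel_integrable hg)
  => x h1 h2 _.
rewrite /kernel_op -[RHS]/(a * (\int[P x]_y f y) + \int[P x]_y g y).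
rewrite -RintegralZl// -RintegralD//.
by have := integrableZl measurableT a h1; apply: eq_integrable.
Qed.

Let kernel_op_mean_ge0 f : L2 pi f -> (forall x, 0 <= f x) ->
  \int[pi]_x kernel_op P f x = \int[pi]_x f x.
Proof.
move=> hf f0; have mf := L2_measurable hf.
have mef : measurable_fun [set: X] (fun x => (f x)%:E) by exact/measurable_EFinP.
congr fine; rewrite -(ge0_stationary mef)//.
apply: ge0_ae_eq_integral => //.
- exact/measurable_EFinP/measurable_kernel_op.
- apply: measurable_fun_integral_kernel => // U mU; exact: measurable_kernel.
- by move=> x _; rewrite lee_fin Rintegral_ge0.
- by move=> x _; apply: integral_ge0 => y _; rewrite lee_fin.
apply: filterS (ae_kernel_integrable hf) => x hx _ /=.
by rewrite /kernel_op /Rintegral fineK//; exact: integrable_fin_num.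
Qed.

Lemma kernel_op_mean f : L2 pi f ->
  L2_inner pi (kernel_op P f) (cst 1) = L2_inner pi f (cst 1).
Proof.
move=> hf; have mf := L2_measurable hf.
(* Stationarity is available for nonnegative functions; f is the difference of f + |f| and |f|, both
   nonnegative and square-integrable. *)
have hn : L2 pi (fun x => `|f x|).
  apply/L2P; split; first exact: measurableT_comp.
  by under eq_integral do rewrite real_normK ?num_real//; case/L2P: hf.
have hp : L2 pi (1 *: f + (fun x => `|f x|))
  by exact: subspaceP (L2_sub_submod pi) _ _ _ hf hn.
have ip1 h : L2_inner pi h (cst 1) = \int[pi]_x h x.
  by apply: eq_Rintegral => x _; rewrite mulr1.
have e1 := kernel_op_mean_ge0 hn (fun x => normr_ge0 _).
have e2 : \int[pi]_x kernel_op P (1 *: f + (fun x => `|f x|)) x =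
          \int[pi]_x (1 *: f + (fun x => `|f x|)) x.
  apply: kernel_op_mean_ge0 => // x; rewrite -[leRHS]/(1 * f x + `|f x|) mul1r.
  by have := ler_norm (- f x); rewrite normrN; lra.
have h1 := L2_cst pi 1.
have hPf := L2_kernel_op hf; have hPn := L2_kernel_op hn;
  have hPp := L2_kernel_op hp.
move: e1 e2; rewrite -!ip1.
rewrite (ae_L2_inner hPp _ h1 (kernel_op_linear 1 hf hn)); last first.
  exact: subspaceP (L2_sub_submod pi) _ _ _ hPf hPn.
rewrite !L2_innerD ?L2_innerZ ?mul1r//; try exact: subspaceZ (L2_sub_submod pi) _.
by move=> ->; exact: addIr.
Qed.

End Stationary.

Lemma integral_cst_probability (R : realType) d (X : measurableType d)
    (nu : probability X R) (c : R) : (\int[nu]_x c%:E = c%:E)%E.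
Proof.
by rewrite integral_cst// [X in (_ * X)%E](_ : _ = 1%E) ?mule1//;
  exact: probability_setT.
Qed.

Lemma Rintegral_cst_probability (R : realType) d (X : measurableType d)
    (nu : probability X R) (c : R) : \int[nu]_x c = c.
Proof. by rewrite /Rintegral integral_cst_probability. Qed.

(** * Averages over a group action *)

Section MeasurePreserving.
Context (R : realType) d (X : measurableType d) (nu : {measure set X -> \bar R}).
Context (t : X -> X) (mt : measurable_fun [set: X] t).
Hypothesis nut : forall A, measurable A -> nu (t @^-1` A) = nu A.

Lemma integral_preserved (f : X -> \bar R) : measurable_fun [set: X] f ->
  (\int[nu]_x f (t x) = \int[nu]_x f x)%E.
Proof.
have ge0 (h : X -> \bar R) : measurable_fun [set: X] h -> (forall x, 0 <= h x)%E ->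
    (\int[nu]_x h (t x) = \int[nu]_x h x)%E.
  move=> mh h0; transitivity (\int[pushforward nu t]_x h x)%E.
    by rewrite ge0_integral_pushforward.
  by apply: eq_measure_integral => A mA _; exact: nut.
move=> mf; rewrite integralE [RHS]integralE; congr (_ - _)%E.
  rewrite -(ge0 (f^\+)%E)//; last exact: measurable_funepos.
  by apply: eq_integral => x _; rewrite !funeposE.
rewrite -(ge0 (f^\-)%E)//; last exact: measurable_funeneg.
by apply: eq_integral => x _; rewrite !funenegE.
Qed.

Lemma Rintegral_preserved (f : X -> R) : measurable_fun [set: X] f ->
  \int[nu]_x f (t x) = \int[nu]_x f x.
Proof.
move=> mf; congr fine; rewrite -(integral_preserved (f := EFin \o f))//.
exact/measurable_EFinP.
Qed.

End MeasurePreserving.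

(** * Averages of a bounded measurable family in L2 *)

Section Average.
Context (R : realType) d d' (T : measurableType d) (X : measurableType d').
Context (mu : probability T R) (pi : probability X R) (F : T * X -> R).
Hypotheses (mF : measurable_fun [set: T * X] F) (F_L2 : forall g,
  L2 pi (fun x => F (g, x))).
Context (c : R).
Hypothesis F_le : forall g, L2_inner pi (fun x => F (g, x)) (fun x => F (g,
  x)) <= c.

Let A x : R := \int[mu]_g F (g, x).

Let mF2 : measurable_fun [set: T * X] (fun z => (F z ^+ 2)%:E).
Proof. exact/measurable_EFinP/measurable_funX. Qed.

Let F2_le : (\int[mu \x pi]_z ((F z ^+ 2)%:E) <= c%:E)%E.
Proof.
rewrite fubini_tonelli1//; last by move=> z; rewrite lee_fin sqr_ge0.
rewrite /fubini_F.
apply: (@le_trans _ _ (\int[mu]_g c%:E)%E); last first.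
  by rewrite integral_cst_probability.
apply: ge0_le_integral => //.
- by move=> g _; apply: integral_ge0 => x _; rewrite lee_fin sqr_ge0.
- by apply: (measurable_fun_fubini_tonelli_F (fun z => (F z ^+ 2)%:E)) => // z;
    rewrite lee_fin sqr_ge0.
- by move=> g _; rewrite -L2_innerE// lee_fin.
Qed.

Let F_int h : L2 pi h ->
  (mu \x pi)%E.-integrable [set: T * X] (EFin \o (fun z => h z.2 * F z)).
Proof.
move=> hh; have mh := L2_measurable hh.
have mh2 : measurable_fun [set: T * X] (fun z : T * X => h z.2).
  exact: measurableT_comp mh measurable_snd.
apply: (@le_integrable _ _ _ _ _ measurableT _ (fun z => (h z.2 ^+ 2)%:E + (F z
  ^+ 2)%:E)%E).
- by apply/measurable_EFinP; exact: measurable_funM.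
- move=> z _; rewrite -EFinD /= lee_fin [leRHS]ger0_norm ?addr_ge0 ?sqr_ge0//.
  by rewrite ler_norml; have := sqr_ge0 (h z.2 - F z);
    have := sqr_ge0 (h z.2 + F z); nra.
apply: integrableD => //; apply/integrableP; split=> //.
- exact/measurable_EFinP/measurable_funX.
- under eq_integral do rewrite gee0_abs ?lee_fin ?sqr_ge0//.
  rewrite fubini_tonelli1//; last 2 first.
  - exact/measurable_EFinP/measurable_funX.
  - by move=> z; rewrite lee_fin sqr_ge0.
  rewrite /fubini_F /= -L2_innerE// integral_cst_probability.
  exact: ltry.
- under eq_integral do rewrite gee0_abs ?lee_fin ?sqr_ge0//.
  by apply: (le_lt_trans F2_le); exact: ltry.
Qed.

Let F_int1 : (mu \x pi)%E.-integrable [set: T * X] (EFin \o F).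
Proof.
have := F_int (L2_cst pi 1); apply: eq_integrable => // z _ /=.
by rewrite mul1r.
Qed.

Lemma L2_average : L2 pi A.
Proof.
apply/L2P; split.
  by apply: measurableT_comp => //; exact: measurable_fubini_G F_int1.
apply: (@le_lt_trans _ _ c%:E); last exact: ltry.
apply: le_trans F2_le; rewrite fubini_tonelli2//; last by move=> z;
  rewrite lee_fin sqr_ge0.
apply: ge0_le_integral => //.
- by move=> x _; rewrite lee_fin sqr_ge0.
- apply/measurable_EFinP/measurable_funX.
  by apply: measurableT_comp => //; exact: measurable_fubini_G F_int1.
- by apply: (measurable_fun_fubini_tonelli_G (fun z => (F z ^+ 2)%:E)) => // z;
    rewrite lee_fin sqr_ge0.
- move=> x _; apply: jensen_sqr; first exact: probability_setT.
  exact: measurableT_comp mF (measurable_pair2 _).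
Qed.

Lemma integrable_average h : L2 pi h ->
  mu.-integrable [set: T] (EFin \o (fun g => L2_inner pi h (fun x => F (g, x)))).
Proof.
move=> hh; have := integrable_fubini_F (F_int hh);
  apply: eq_integrable => // g _ /=.
rewrite /fubini_F /= fineK//.
by apply: integrable_fin_num => //; exact: L2_mul_integrable.
Qed.

Lemma L2_inner_average h : L2 pi h ->
  L2_inner pi h A = \int[mu]_g L2_inner pi h (fun x => F (g, x)).
Proof.
move=> hh.
transitivity (fine (\int[pi]_x (fubini_G mu (EFin \o (fun z : T * X => h z.2 * F
  z)%R) x))).
  congr fine; apply: ae_eq_integral => //.
  - by case/integrableP: (L2_mul_integrable hh L2_average).
  - exact: measurable_fubini_G (F_int hh).
  (* Pulling h x out of the integral over g requires F (., x) to be integrable, which Fubini gives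
     for almost every x. *)
  apply: filterS (ae_integrable2 F_int1) => x hx _.
  rewrite /fubini_G /A EFinM /Rintegral fineK; last exact: integrable_fin_num.
  by rewrite -integralZl//; apply: eq_integral => g _; rewrite -EFinM.
rewrite -Fubini; last exact: F_int.
congr fine; apply: eq_integral => g _; rewrite /fubini_F /=.
rewrite fineK//; apply: integrable_fin_num => //; exact: L2_mul_integrable.
Qed.

End Average.

Section BorelContinuity.
Context (T : ptopologicalType).

Lemma continuous_borel_measurable (f : T -> T) : continuous f ->
  measurable_fun [set: borel T] (f : borel T -> borel T).
Proof.
move=> /continuousP cf.
apply: (@measurability _ _ (borel T) (borel T) setT f open) => //.
move=> _ [B oB <-]; rewrite setTI; apply: sub_sigma_algebra; exact: cf.
Qed.

End BorelContinuity.

Section Action.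
Context (R : realType) (G : topologicalGroupType) d (X : measurableType d).
Context (pi : probability X R) (mu : probability (borel G) R).
Context (act : G -> X -> X) (hact : measurable_action act).
Hypothesis hpi : invariant_measure act pi.
Hypothesis hmu : forall (g : G) (A : set (borel G)), measurable A ->
  mu [set (g * h)%g | h in A] = mu A.
Implicit Types (f h v : X -> R) (g : G).

Local Notation U := (U_op act).
Local Notation V := (inv_space act pi).
Local Notation ipf := (L2_inner pi).

Lemma measurable_mulgl g : measurable_fun [set: borel G] (fun h : borel G => (g *
  h)%g : borel G).
Proof.
apply: (@continuous_borel_measurable G) => h.
have c1 : (g, h') @[h' --> h] --> (g, h) by apply: cvg_pair;
  [exact: cvg_cst|exact: cvg_id].
exact: cvg_comp c1 (@mulg_continuous G (g, h)).
Qed.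

Lemma measurable_invg : measurable_fun [set: borel G] (fun h : borel G =>
  (h^-1)%g : borel G).
Proof. exact: (@continuous_borel_measurable G _ (@invg_continuous G)). Qed.

Lemma measurable_act g : measurable_fun [set: X] (act g).
Proof.
exact: measurableT_comp (action_measurable hact) (@measurable_pair1 _ _ (borel G)
  X g).
Qed.

Lemma actK g x : act g (act g^-1%g x) = x.
Proof. by rewrite -(action_mul hact) mulgV (action_one hact). Qed.

Lemma actVK g x : act g^-1%g (act g x) = x.
Proof. by rewrite -(action_mul hact) mulVg (action_one hact). Qed.

Lemma act_preserves g A : measurable A -> pi (act g @^-1` A) = pi A.
Proof.
move=> mA; rewrite -(hpi g^-1%g mA); congr (pi _); apply/seteqP; split.
  by move=> x /= hx; exists (act g x) => //; exact: actVK.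
by move=> _ /= [x hx <-]; rewrite actK.
Qed.

Lemma L2_U_op g f : L2 pi f -> L2 pi (U g f).
Proof.
move=> /L2P[mf hf]; apply/L2P; split;
  first exact: measurableT_comp mf (measurable_act g).
rewrite (integral_preserved (measurable_act g) (act_preserves g) (f :=
  fun x => (f x ^+ 2)%:E))//.
exact/measurable_EFinP/measurable_funX.
Qed.

Lemma L2_inner_U_op g f h : L2 pi f -> L2 pi h -> ipf (U g f) (U g h) = ipf f h.
Proof.
move=> hf hh; apply: (Rintegral_preserved (measurable_act g) (act_preserves g)
  (f := fun x => f x * h x)).
by apply: measurable_funM; [exact: L2_measurable hf|exact: L2_measurable hh].
Qed.

Lemma U_opK g f : U g (U g^-1%g f) = f.
Proof. by apply/funext => x; rewrite /U_op actVK. Qed.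

Lemma L2_inner_U_op_adj g f h : L2 pi f -> L2 pi h ->
  ipf (U g f) h = ipf f (U g^-1%g h).
Proof. by move=> hf hh; rewrite -{1}(U_opK g h) L2_inner_U_op//;
  exact: L2_U_op. Qed.

Lemma inv_space_inner g f v : L2 pi f -> V v -> ipf (U g f) v = ipf f v.
Proof.
move=> hf [hv iv]; rewrite L2_inner_U_op_adj// !(L2_innerC _ f).
by apply: ae_L2_inner => //; exact: L2_U_op.
Qed.

Definition avg_inv f : X -> R := fun x => \int[mu]_g f (act g^-1%g x).

Let mact : measurable_fun [set: borel G * X] (fun z : borel G * X => act z.1 z.2).
Proof. exact: action_measurable hact. Qed.

Let mactV : measurable_fun [set: borel G * X] (fun z : borel G * X => act
  z.1^-1%g z.2).
Proof.
have h : measurable_fun [set: borel G * X] (fun z : borel G * X => (z.1^-1%g :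
  borel G, z.2)).
  apply/measurable_fun_pairP; split => /=; last exact: measurable_snd.
  exact: (measurableT_comp measurable_invg measurable_fst).
exact: measurableT_comp mact h.
Qed.

Let mU f : L2 pi f -> measurable_fun [set: borel G * X] (fun z : borel G * X => f
  (act z.1 z.2)).
Proof. by move=> hf; exact: measurableT_comp (L2_measurable hf) mact. Qed.

Let mUV f : L2 pi f ->
  measurable_fun [set: borel G * X] (fun z : borel G * X => f (act z.1^-1%g z.2)).
Proof. by move=> hf; exact: measurableT_comp (L2_measurable hf) mactV. Qed.

Let UV_le g f : L2 pi f -> ipf (U g f) (U g f) <= ipf f f.
Proof. by move=> hf; rewrite L2_inner_U_op. Qed.

Lemma L2_avg f : L2 pi f -> L2 pi (avg act mu f).
Proof.
move=> hf; exact: (L2_average mu (mU hf) (fun g => L2_U_op g hf)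
  (fun g => UV_le g hf)).
Qed.

Lemma L2_avg_inv f : L2 pi f -> L2 pi (avg_inv f).
Proof.
move=> hf; exact: (L2_average mu (mUV hf) (fun g => L2_U_op g^-1%g hf)
  (fun g => UV_le g^-1%g hf)).
Qed.

Lemma L2_inner_avg f h : L2 pi f -> L2 pi h ->
  ipf h (avg act mu f) = \int[mu]_g ipf h (U g f).
Proof.
move=> hf; exact: (L2_inner_average mu (mU hf) (fun g => L2_U_op g hf)
  (fun g => UV_le g hf)).
Qed.

Lemma L2_inner_avg_inv f h : L2 pi f -> L2 pi h ->
  ipf h (avg_inv f) = \int[mu]_g ipf h (U g^-1%g f).
Proof.
move=> hf; exact: (L2_inner_average mu (mUV hf) (fun g => L2_U_op g^-1%g hf)
  (fun g => UV_le g^-1%g hf)).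
Qed.

Lemma integrable_avg_inv f h : L2 pi f -> L2 pi h ->
  mu.-integrable [set: borel G] (EFin \o (fun g => ipf h (U g^-1%g f))).
Proof.
move=> hf; exact: (integrable_average mu (mUV hf) (fun g => L2_U_op g^-1%g hf)
  (fun g => UV_le g^-1%g hf)).
Qed.

(* U_g0 composed with U_(g^-1) is U_(k^-1) for k = g0^-1 g, so left invariance
   is what is needed here; [avg], which averages U_g, would need the right one. *)
Lemma avg_inv_invariant g0 f : measurable_fun [set: X] f ->
  U g0 (avg_inv f) = avg_inv f.
Proof.
move=> mf; apply/funext => x; rewrite /U_op /avg_inv.
pose phi (g : borel G) := f (act g^-1%g x).
have mphi : measurable_fun [set: borel G] phi.
  exact: measurableT_comp mf (measurableT_comp mactV (measurable_pair2 _)).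
rewrite -[RHS](Rintegral_preserved (measurable_mulgl g0^-1%g) _ mphi).
  apply: eq_Rintegral => g _; rewrite /phi invgM invgK.
  by rewrite -(action_mul hact).
move=> A mA; transitivity (mu [set (g0 * h)%g | h in A]); last exact: hmu.
congr (mu _); apply/seteqP; split.
  by move=> h /= hh; exists (g0^-1 * h)%g => //; rewrite mulgA mulgV mul1g.
by move=> _ /= [h hh <-]; rewrite mulgA mulVg mul1g.
Qed.

Lemma avg_inv_in f : L2 pi f -> V (avg_inv f).
Proof.
move=> hf; split; first exact: L2_avg_inv.
by move=> g /=; rewrite (avg_inv_invariant g (L2_measurable hf)); exact: aeW.
Qed.

Lemma avg_inv_orth f v : L2 pi f -> V v -> ipf (f - avg_inv f) v = 0.
Proof.
move=> hf hv; have [hv2 _] := hv; have ha := L2_avg_inv hf.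
rewrite L2_innerB// (L2_innerC _ (avg_inv f)) L2_inner_avg_inv//.
under eq_Rintegral do rewrite L2_innerC inv_space_inner//.
by rewrite Rintegral_cst_probability subrr.
Qed.

Lemma avg_avg_inv f h : L2 pi f -> L2 pi h ->
  ipf (avg act mu f) h = ipf (avg_inv f) h.
Proof.
move=> hf hh; rewrite L2_innerC L2_inner_avg//.
under eq_Rintegral do rewrite L2_innerC L2_inner_U_op_adj//.
rewrite -L2_inner_avg_inv//.
have ha := L2_avg_inv hf; have hah := L2_avg_inv hh.
have e1 := avg_inv_orth hf (avg_inv_in hh).
have e2 := avg_inv_orth hh (avg_inv_in hf).
move: e1 e2; rewrite (L2_innerB hf ha hah) (L2_innerB hh hah ha).
move=> /subr0_eq -> /subr0_eq e; rewrite (L2_innerC _ _ h) e; exact: L2_innerC.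
Qed.

Context (P : R.-pker X ~> X) (hP : stationary pi P).

Let Psym f (z : borel G * X) := kernel_op P (U z.1^-1%g f) (act z.1 z.2).

(** The integrand depends on g as well, so P is first viewed as a kernel from G * X that ignores g;
    the result is then composed with (g, x) -> (g, g x). *)
Let measurable_Psym f : L2 pi f -> measurable_fun [set: borel G * X] (Psym f).
Proof.
move=> hf.
pose k := @kernel.kernel_snd _ _ _ (borel G) X X R P.
have mf : measurable_fun [set: (borel G * X) * X]
    (fun w : (borel G * X) * X => f (act w.1.1^-1%g w.2)).
  have h : measurable_fun [set: (borel G * X) * X] (fun w : (borel G * X)
    * X => (w.1.1, w.2)).
    apply/measurable_fun_pairP; split => /=; last exact: measurable_snd.
    exact: measurableT_comp measurable_fst measurable_fst.
  exact: measurableT_comp (L2_measurable hf) (measurableT_comp mactV h).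
have mk := measurable_kernel_Rintegral k mf.
have h : measurable_fun [set: borel G * X] (fun z : borel G * X => (z.1,
  act z.1 z.2)).
  by apply/measurable_fun_pairP; split => /=; [exact: measurable_fst|exact: mact].
exact: measurableT_comp mk h.
Qed.

Let L2_PU g f : L2 pi f -> L2 pi (kernel_op P (U g^-1%g f)).
Proof. by move=> hf; apply: L2_kernel_op => //; exact: L2_U_op. Qed.

Let Psym_le f g : L2 pi f ->
  ipf (fun x => Psym f (g, x)) (fun x => Psym f (g, x)) <= ipf f f.
Proof.
move=> hf; rewrite (L2_inner_U_op g (L2_PU g hf) (L2_PU g hf)).
by rewrite -(L2_inner_U_op g^-1%g hf hf) kernel_op_contraction//; exact: L2_U_op.
Qed.

Let L2_Psym f g : L2 pi f -> L2 pi (fun x => Psym f (g, x)).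
Proof. by move=> hf; exact: L2_U_op g _ (L2_PU g hf). Qed.

Let sym_opE f : sym_op act mu (kernel_op P) f = (fun x => \int[mu]_g Psym f (g, x)).
Proof. by []. Qed.

Lemma L2_sym_op f : L2 pi f -> L2 pi (sym_op act mu (kernel_op P) f).
Proof.
by move=> hf; rewrite sym_opE; exact: (L2_average mu (measurable_Psym hf)
  (fun g => @L2_Psym f g hf) (fun g => @Psym_le f g hf)).
Qed.

Let sym_op_inner_g g f : L2 pi f ->
  ipf f (fun x => Psym f (g, x)) = ipf (U g^-1%g f) (kernel_op P (U g^-1%g f)).
Proof.
by move=> hf; rewrite L2_innerC (L2_inner_U_op_adj g (L2_PU g hf) hf) L2_innerC.
Qed.

Lemma L2_inner_sym_op f : L2 pi f ->
  ipf f (sym_op act mu (kernel_op P) f) =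
  \int[mu]_g ipf (U g^-1%g f) (kernel_op P (U g^-1%g f)).
Proof.
move=> hf.
have e := L2_inner_average mu (measurable_Psym hf) (fun g => @L2_Psym f g hf)
  (fun g => @Psym_le f g hf) hf.
rewrite sym_opE; apply: (etrans e); apply: eq_Rintegral => g _;
  exact: sym_op_inner_g.
Qed.

Lemma integrable_sym_op f : L2 pi f -> mu.-integrable [set: borel G]
  (EFin \o (fun g => ipf (U g^-1%g f) (kernel_op P (U g^-1%g f)))).
Proof.
move=> hf.
have := integrable_average mu (measurable_Psym hf) (fun g => @L2_Psym f g hf)
  (fun g => @Psym_le f g hf) hf.
apply: eq_integrable => // g _ /=.
by rewrite sym_op_inner_g.
Qed.

End Action.

(** * The gap of a compact Markov kernel *)

Section KernelOperator.
Context (R : realType) d (X : measurableType d) (pi : probability X R).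
Context (P : R.-pker X ~> X) (hP : stationary pi P).
Implicit Types f h : X -> R.
Local Notation H := (L2T pi).
Local Notation ipf := (L2_inner pi).
Local Notation ip := (@L2T_inner R d X pi).
Local Notation q x := (ip x x).
Local Notation P_ := (kernel_op P).
Let hE := L2_semi_hilbert pi.

Lemma L2_norm_sqr f : L2_norm pi f ^+ 2 = ipf f f.
Proof. by rewrite sqr_sqrtr ?L2_inner_ge0. Qed.

Lemma L2_norm_eq1 f : L2_norm pi f = 1 <-> ipf f f = 1.
Proof.
split=> [h|h]; first by rewrite -L2_norm_sqr h expr1n.
by rewrite /L2_norm h sqrtr1.
Qed.

Lemma ae_null (f g : H) : f = g %[ae pi] <-> q (f - g) = 0.
Proof.
have hd : L2 pi (f - g : X -> R) by exact: L2B (L2T_L2 f) (L2T_L2 g).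
have e : q (f - g) = ipf ((f : X -> R) - (g : X -> R)) ((f : X -> R) - (g : X ->
  R)) by [].
rewrite e (L2_inner_eq0 hd); split; apply: filterS => x /= h xT.
  by rewrite -[LHS]/(f x - g x) h// subrr.
have e0 : f x - g x = 0 := h xT.
by apply/eqP; rewrite -subr_eq0 e0.
Qed.

Definition kernel_opT (f : H) : H := toL2 (L2_kernel_op hP (L2T_L2 f)).

Lemma kernel_opT_lin a (x y z : H) : ip (kernel_opT (a *: x + y))
  z = a * ip (kernel_opT x) z + ip (kernel_opT y) z.
Proof.
rewrite -(ipZl hE) -(ipDl hE); apply: ae_L2_inner; try exact: L2T_L2.
exact: kernel_op_linear hP _ _ _ (L2T_L2 x) (L2T_L2 y).
Qed.

Lemma kernel_opT_contr (x : H) : q (kernel_opT x) <= q x.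
Proof. exact: kernel_op_contraction hP _ (L2T_L2 x). Qed.

(** [L2_adjoint] is a choice with default value 0, so it is meaningful only once a candidate exists:
    if Q is the Riesz adjoint of P, then Q - I serves for P - I. *)
Lemma generator_adjoint f : L2 pi f -> L2 pi (L2_adjoint pi (generator P_) f) /\
  forall k, L2 pi k -> ipf (generator P_ k)
    f = ipf k (L2_adjoint pi (generator P_) f).
Proof.
move=> hf; apply: (@xgetPex _ (cst 0) [set h | L2 pi h /\
  forall k, L2 pi k -> ipf (generator P_ k) f = ipf k h]).
have [Q hQ] := adjoint_exists hE kernel_opT_lin kernel_opT_contr.
pose x := toL2 hf; exists ((Q x - x : H) : X -> R); split;
  first exact: (L2T_L2 (Q x - x)).
move=> k hk; rewrite L2_innerB//; last exact: L2_kernel_op.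
have := hQ (toL2 hk) x; rewrite -/(ipf k f) => e.
have -> : ipf (P_ k) f = ip (kernel_opT (toL2 hk)) x by [].
by rewrite e -[ipf k f]/(ip (toL2 hk) x) -(ipNr hE x) -(ipDr hE (Q x)).
Qed.

Local Notation N := (neg_sym_gen pi P_).

Lemma L2_generator f : L2 pi f -> L2 pi (generator P_ f).
Proof. by move=> hf; apply: L2B => //; exact: L2_kernel_op. Qed.

Lemma neg_sym_genE f : N f = - (2^-1 *: (generator P_ f + L2_adjoint pi
  (generator P_) f)).
Proof. by apply/funext => x; rewrite /neg_sym_gen mulrC. Qed.

Lemma L2_neg_sym_gen f : L2 pi f -> L2 pi (N f).
Proof.
move=> hf; have [ha _] := generator_adjoint hf; rewrite neg_sym_genE.
have s := L2_sub_submod pi.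
by apply: subspaceN => //; apply: subspaceZ => //; apply: subspaceD => //;
  exact: L2_generator.
Qed.

Lemma neg_sym_gen_inner f k : L2 pi f -> L2 pi k ->
  ipf (N f) k = ipf f k - (ipf (P_ f) k + ipf f (P_ k)) / 2.
Proof.
move=> hf hk; have [ha ea] := generator_adjoint hf; rewrite neg_sym_genE.
have s := L2_sub_submod pi; have hg := L2_generator hf.
have hPf := L2_kernel_op hP hf; have hPk := L2_kernel_op hP hk.
have hs : L2 pi (generator P_ f + L2_adjoint pi (generator P_) f)
  by exact: subspaceD.
rewrite -scaleN1r L2_innerZ//; last exact: subspaceZ.
rewrite L2_innerZ// L2_innerD// (L2_innerC _ (L2_adjoint _ _ _)) -ea//.
by rewrite !L2_innerB// (L2_innerC _ k f) (L2_innerC _ (P_ k)); field.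
Qed.

Definition neg_sym_genT (f : H) : H := toL2 (L2_neg_sym_gen (L2T_L2 f)).
(** Up to null vectors this is half the sum of P and its adjoint, because L = P - I; an eigenvalue c
    of [neg_sym_gen] corresponds to 1 - c here. *)
Definition sym_part (f : H) : H := f - neg_sym_genT f.

Lemma sym_partE (x y : H) : ip (sym_part x) y = (ip (kernel_opT x)
  y + ip x (kernel_opT y)) / 2.
Proof.
rewrite (ipDl hE) (ipNl hE).
have -> : ip (neg_sym_genT x) y = ip x y - (ip (kernel_opT x)
  y + ip x (kernel_opT y)) / 2.
  exact: neg_sym_gen_inner (L2T_L2 x) (L2T_L2 y).
by ring.
Qed.

Lemma sym_part_sym : symmetric_on ip [set: H] sym_part.
Proof. exact: (symmetric_part_sym hE kernel_opT_contr sym_partE). Qed.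

Lemma kernel_opT_compact : compact_operator pi P_ ->
  compact_on ip [set: H] kernel_opT.
Proof.
move=> hc u _ [B hB].
have [||k hk [h hh hl]] := hc (fun n => u n); first by move=> n; exact: L2T_L2.
  by exists (Num.sqrt B) => n; rewrite ler_wsqrtr// hB.
exists k => //; exists (toL2 hh).
rewrite /converges (_ : (fun n => _) = (fun n => L2_norm pi (P_ (u (k n)) \- h)
  * L2_norm pi (P_ (u (k n)) \- h))).
  by rewrite -[X in _ --> X](mulr0 0); exact: cvgM.
by apply/funext => n; rewrite -expr2 L2_norm_sqr.
Qed.

Definition L2T_one : H := toL2 (L2_cst pi 1).
Definition L2T0 : set H := orth ip [set L2T_one].

Lemma L2T0_closed_subspace : closed_subspace ip L2T0.
Proof. exact: orth_csub hE _. Qed.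

Lemma L2T0E (f : H) : L2T0 f <-> ip f L2T_one = 0.
Proof. by split => [|h y ->//]; apply. Qed.

Lemma L20P f : L20 pi f <-> exists2 x : H, x = f :> (X -> R) & L2T0 x.
Proof.
split=> [[hf h0]|[x <-] /L2T0E h0]; last by split => //; exact: L2T_L2.
by exists (toL2 hf) => //; apply/L2T0E.
Qed.

Lemma kernel_opT_one : q (kernel_opT L2T_one - L2T_one) = 0.
Proof.
apply/ae_null; apply: aeW => x _ /=.
transitivity (\int[P x]_y (1 : R)); first by [].
by rewrite Rintegral_cst// kernel_mass mul1r.
Qed.

Lemma kernel_opT_mean (x : H) : ip (kernel_opT x) L2T_one = ip x L2T_one.
Proof. exact: kernel_op_mean hP _ (L2T_L2 x). Qed.

Lemma sym_part_mean (x : H) : ip (sym_part x) L2T_one = ip x L2T_one.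
Proof.
by rewrite sym_partE kernel_opT_mean (ipC hE x (kernel_opT L2T_one))
  (null_eq hE _ kernel_opT_one) (ipC hE L2T_one); field.
Qed.

Lemma sym_part_L2T0 (x : H) : L2T0 x -> L2T0 (sym_part x).
Proof. by move=> /L2T0E h; apply/L2T0E; rewrite sym_part_mean. Qed.

Lemma sym_part_sym0 : symmetric_on ip L2T0 sym_part.
Proof. exact: sym_sub (@subsetT _ _) sym_part_L2T0 sym_part_sym. Qed.

Lemma sym_part_compact : compact_operator pi P_ -> compact_on ip L2T0 sym_part.
Proof.
move=> /kernel_opT_compact hc; apply: compact_sub (@subsetT _ _) _.
exact: (symmetric_part_compact hE kernel_opT_lin kernel_opT_contr sym_partE hc).
Qed.

End KernelOperator.

Section RightGap.
Context (R : realType) d (X : measurableType d) (pi : probability X R).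
Implicit Types (f : X -> R) (T : (X -> R) -> X -> R).

Lemma L2_inner_generator T f : L2 pi f -> L2 pi (T f) ->
  L2_inner pi f (\- generator T f) = L2_inner pi f f - L2_inner pi f (T f).
Proof.
move=> hf hT; rewrite (L2_innerC _ f (T f)) -L2_innerB//.
by rewrite L2_innerC; congr L2_inner; apply/funext => x;
  rewrite /generator /= opprB.
Qed.

Lemma right_gap_ge T (b : R) : (forall f, L2 pi f -> L2 pi (T f)) ->
  (exists2 f, L20 pi f & L2_inner pi f f = 1) ->
  (forall f, L20 pi f -> L2_inner pi f f = 1 -> L2_inner pi f (T f) <= 1 - b) ->
  b <= right_gap pi T.
Proof.
move=> hT [f0 h0 q0] hb; apply: lb_le_inf.
  by exists (L2_inner pi f0 (\- generator T f0)); exists f0 => //; split => //;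
    apply/L2_norm_eq1.
move=> _ [f [hf /L2_norm_eq1 qf] <-]; have hf2 : L2 pi f by case: hf.
rewrite L2_inner_generator//; last exact: hT.
by rewrite qf; have := hb f hf qf; lra.
Qed.

End RightGap.

Section Spectrum.
Context (R : realType) d (X : measurableType d) (pi : probability X R).
Context (P : R.-pker X ~> X) (hP : stationary pi P).
Hypothesis hcpt : compact_operator pi (kernel_op P).
Implicit Types f h : X -> R.
Local Notation H := (L2T pi).
Local Notation ipf := (L2_inner pi).
Local Notation ip := (@L2T_inner R d X pi).
Local Notation q x := (ip x x).
Local Notation P_ := (kernel_op P).
Local Notation N := (neg_sym_gen pi P_).
Local Notation sym_part := (sym_part hP).
Local Notation L2T_one := (L2T_one pi).
Local Notation L2T0 := (@L2T0 R d X pi).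
Local Notation lam := (right_gap pi P_).
Context (lambda2 : R) (hl2 : next_eigenvalue pi N lam lambda2).
Let hE := L2_semi_hilbert pi.
Let sH0 := csub_sub (L2T0_closed_subspace pi).

Lemma sym_part_form_le1 (x : H) : ip (sym_part x) x <= q x.
Proof.
rewrite sym_partE (ipC hE x).
have -> : (ip (kernel_opT hP x) x + ip (kernel_opT hP x) x)
  / 2 = ip (kernel_opT hP x) x by field.
have := ip_ge0 hE (x - kernel_opT hP x); have := kernel_opT_contr hP x.
by rewrite !(ipE hE) (ipC hE x (kernel_opT hP x)); lra.
Qed.

Lemma sym_part_diag (x : H) : ip (sym_part x) x = ipf x (P_ x).
Proof.
rewrite sym_partE (ipC hE (kernel_opT hP x)).
have -> : ip x (kernel_opT hP x) = ipf x (P_ x) by [].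
by field.
Qed.

Lemma right_gap_form_le (x : H) : L2T0 x -> ip (sym_part x) x <= (1 - lam) * q x.
Proof.
move=> hx; apply: (homogeneous_le hE sH0 (sym_part_sym0 hP)) hx => {}x hx qx.
suff : lam <= 1 - ip (sym_part x) x by lra.
apply: ge_inf.
  exists 0 => _ [f [[hf _] _] <-].
  rewrite L2_inner_generator//; last exact: L2_kernel_op.
  have := sym_part_form_le1 (toL2 hf); rewrite sym_part_diag.
  by have -> : q (toL2 hf) = ipf f f by []; rewrite subr_ge0.
exists x; first by split; [apply/L20P; exists x|apply/L2_norm_eq1].
rewrite L2_inner_generator; [|exact: L2T_L2|exact: L2_kernel_op (L2T_L2 x)].
by rewrite sym_part_diag; congr (_ - _); exact/esym.
Qed.

Lemma right_gap_ge0 : 0 <= lam.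
Proof.
rewrite /right_gap; set A := (X in inf X).
have [->|/set0P A0] := eqVneq A set0; first by rewrite inf0.
apply: lb_le_inf => // _ [f [[hf _] _] <-].
rewrite L2_inner_generator//; last exact: L2_kernel_op.
have := sym_part_form_le1 (toL2 hf); rewrite sym_part_diag.
by have -> : q (toL2 hf) = ipf f f by []; rewrite subr_ge0.
Qed.

Lemma eigenspaceP (c : R) (x : H) :
  L2_eigenspace pi N c x <-> q (sym_part x - (1 - c) *: x) = 0.
Proof.
have e : sym_part x - (1 - c) *: x = c *: x - neg_sym_genT hP x.
  by rewrite /sym_part scalerBl scale1r opprB addrC addrA subrK.
rewrite e; split => [[_ h]|h].
  by rewrite (qB hE); apply/ae_null.
split; first exact: L2T_L2.
by move: h; rewrite (qB hE) => /ae_null.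
Qed.

Lemma eigenvector_null c (x : H) : lam < c -> c < lambda2 ->
  q (sym_part x - (1 - c) *: x) = 0 -> q x = 0.
Proof.
move=> lc cl h; case: hl2 => _ _ /(_ c) hc; apply: contrapT => qx.
have : lambda2 <= c.
  apply: hc => //; exists x; first exact/eigenspaceP.
  by move=> /(L2_inner_eq0 (L2T_L2 x)).
by rewrite leNgt cl.
Qed.

(** The symmetric part preserves means, so the mean of x equals 1 - c times itself. *)
Lemma eigenvector_mean (c : R) (x : H) : c != 0 ->
  q (sym_part x - (1 - c) *: x) = 0 -> L2T0 x.
Proof.
move=> c0 h; apply/L2T0E; have := sym_part_mean hP x.
rewrite (null_eq hE _ h) (ipZl hE) => /eqP.
rewrite -subr_eq0 mulrBl mul1r addrAC subrr sub0r oppr_eq0 mulf_eq0 (negPf c0) /=.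
by move/eqP.
Qed.

(** The witness is an eigenvector for lambda2, which has mean zero since lambda2 > lambda >= 0. It
    keeps the sets under [inf] and [sup] nonempty. *)
Lemma unit_exists : exists2 x : H, L2T0 x & q x = 1.
Proof.
case: (hl2) => ll [f [hf ef] nf] _; pose x := toL2 hf.
have h : q (sym_part x - (1 - lambda2) *: x) = 0 :=
  (eigenspaceP lambda2 x).1 (conj hf ef).
have qx : q x != 0 by apply/eqP => /(L2_inner_eq0 hf).
have [a a0 ha] := normalize hE qx.
exists (a *: x) => //; apply: (subspaceZ a sH0).
by apply: (eigenvector_mean _ h); rewrite gt_eqF// (le_lt_trans right_gap_ge0).
Qed.

End Spectrum.

(** * Closed subspaces given as sets of functions, and their projections *)

Section ClosedSubspaces.
Context (R : realType) d (X : measurableType d) (pi : probability X R).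
Implicit Types (f h : X -> R) (S : set (X -> R)).
Local Notation H := (L2T pi).
Local Notation ip := (@L2T_inner R d X pi).
Local Notation q x := (ip x x).
Let hE := L2_semi_hilbert pi.

Definition L2_lift S : set H := [set x | S x].

Record L2_closed S : Prop := L2Closed {
  L2_closed_sub : S `<=` L2 pi ;
  L2_closed_csub : closed_subspace ip (L2_lift S) }.

Lemma L2_proj_in S f : L2_closed S -> L2 pi f ->
  S (L2_proj pi S f) /\ L2_orth pi S (f \- L2_proj pi S f).
Proof.
move=> [hS1 hS2] hf; apply: (@xgetPex _ (cst 0)
  [set h | S h /\ L2_orth pi S (f \- h)]).
have [p hp ho] := projection hE (toL2 hf) hS2.
exists (p : X -> R); split => //; split; first exact: L2T_L2 (toL2 hf - p).
by move=> h hh; exact: (ho (toL2 (hS1 _ hh))).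
Qed.

Definition projT S (hS : L2_closed S) (x : H) : H :=
  toL2 (L2_closed_sub hS (L2_proj_in hS (L2T_L2 x)).1).

Lemma projT_in S (hS : L2_closed S) x : L2_lift S (projT hS x).
Proof. exact: (L2_proj_in hS (L2T_L2 x)).1. Qed.

Lemma projT_orth S (hS : L2_closed S) x : orth ip (L2_lift S) (x - projT hS x).
Proof. by move=> y hy; exact: (L2_proj_in hS (L2T_L2 x)).2.2. Qed.

Lemma setT_closed_subspace : closed_subspace ip [set: H].
Proof. by split. Qed.

Lemma projT_contr S (hS : L2_closed S) x : q (projT hS x) <= q x.
Proof.
exact: (@proj_contr _ _ _ hE setT (L2_lift S) _ (fun x _ => projT_in hS x)
  (fun x _ => projT_orth hS x)).
Qed.

End ClosedSubspaces.
Arguments L2_lift {R d X} pi S _.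

(** * The norm of a compressed eigenprojection *)

Section Compression.
Context (R : realType) d (X : measurableType d) (pi : probability X R).
Context (P : R.-pker X ~> X) (hP : stationary pi P).
Hypothesis hcpt : compact_operator pi (kernel_op P).
Local Notation H := (L2T pi).
Local Notation ipf := (L2_inner pi).
Local Notation ip := (@L2T_inner R d X pi).
Local Notation q x := (ip x x).
Local Notation P_ := (kernel_op P).
Local Notation N := (neg_sym_gen pi P_).
Local Notation sym_part := (sym_part hP).
Local Notation L2T_one := (L2T_one pi).
Local Notation L2T0 := (@L2T0 R d X pi).
Local Notation lam := (right_gap pi P_).
Context (lambda2 : R) (hl2 : next_eigenvalue pi N lam lambda2).
Let hE := L2_semi_hilbert pi.
Let sH0 := csub_sub (L2T0_closed_subspace pi).
Local Notation W := (L2_eigenspace pi N lam).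
Local Notation W0 := (eigen_on ip L2T0 sym_part (1 - lam)).

Lemma lt_gap : 1 - lambda2 < 1 - lam.
Proof. by case: hl2 => h _ _; rewrite ltrD2l ltrN2. Qed.

Lemma gap_eigenspace_closed : L2_closed pi W.
Proof.
split; first by move=> f [].
have -> : L2_lift pi W = eigen_on ip setT sym_part (1 - lam).
  by apply/seteqP; split=> x; [move=> /(eigenspaceP hP)|move=> [_] /(eigenspaceP
    hP)].
exact: (eigen_csub hE (setT_closed_subspace pi) (sym_part_sym hP)).
Qed.

Local Notation p := (projT gap_eigenspace_closed).

Let p_in x : L2_lift pi W (p x) := projT_in gap_eigenspace_closed x.
Let p_orth x : orth ip (L2_lift pi W) (x - p x) :=
  @projT_orth _ _ _ _ _ gap_eigenspace_closed x.

Lemma gap_eigenspace_lift x : W0 x -> L2_lift pi W x.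
Proof. by move=> [_ h]; exact/(eigenspaceP hP). Qed.

(** W is taken in all of L^2, the abstract gap theory in mean-zero vectors. If lambda is nonzero, W
    consists of mean-zero vectors; if lambda = 0, W contains the constants, so x - p x has mean
    zero. *)
Lemma projW_in x : L2T0 x -> W0 (p x).
Proof.
move=> hx; have hq := (eigenspaceP hP lam (p x)).1 (p_in x); split => //.
have [l0|l0] := eqVneq lam 0; last exact: (eigenvector_mean l0 hq).
have hone : L2_lift pi W L2T_one.
  apply/(eigenspaceP hP); rewrite l0 subr0 scale1r.
  have hz z : ip (sym_part L2T_one) z = ip L2T_one z.
    by rewrite (sym_ip (sym_part_sym hP))// (ipC hE) sym_part_mean (ipC hE).
  by rewrite (ipDl hE) (ipNl hE) hz subrr.
by apply/L2T0E; have := p_orth x hone; move/L2T0E: hx;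
  rewrite (ipDl hE) (ipNl hE) => -> /eqP;
  rewrite sub0r oppr_eq0 => /eqP.
Qed.

Lemma projW_orth x : L2T0 x -> orth ip W0 (x - p x).
Proof. by move=> hx y /gap_eigenspace_lift; exact: p_orth. Qed.

Let noeig c x : 1 - lambda2 < c -> c < 1 - lam ->
  eigen_on ip L2T0 sym_part c x -> q x = 0.
Proof.
move=> c1 c2 [hx hq]; apply: (@eigenvector_null _ _ _ _ _ hP _ hl2 (1 - c)).
- by move: c2; rewrite ltrBrDl ltrBrDr addrC.
- by move: c1; rewrite ltrBlDl ltrBlDr addrC.
- by have -> : 1 - (1 - c) = c by ring.
Qed.

Lemma form_le_split x : L2T0 x ->
  ip (sym_part x) x <= (1 - lambda2) * q x + (lambda2 - lam) * q (p x).
Proof.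
move=> hx; have -> : lambda2 - lam = (1 - lam) - (1 - lambda2) by ring.
exact: (gap_split hE (L2T0_closed_subspace pi) (sym_part_sym0 hP)
  (sym_part_compact hP hcpt)
  (right_gap_form_le hP) noeig projW_in projW_orth hx).
Qed.

Context (K : set (X -> R)) (hK : L2_closed pi K).
Local Notation pK := (projT hK).
Hypothesis hK0 : forall x, L2T0 x -> L2T0 (pK x).
Local Notation a := (L20_opnorm pi (L2_proj pi K \o L2_proj pi W \o L2_proj pi K)).

Let norms := [set L2_norm pi ((L2_proj pi K \o L2_proj pi W \o L2_proj pi K) f) |
  f in L20 pi `&` [set f | L2_norm pi f = 1]].

Let norms_neq0 : norms !=set0.
Proof.
have [x hx qx] := unit_exists hP hl2.
exists (L2_norm pi ((L2_proj pi K \o L2_proj pi W \o L2_proj pi K) x)).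
by exists x => //; split; [apply/L20P; exists x|apply/L2_norm_eq1].
Qed.

Lemma compression_le (c : R) : 0 <= c ->
  (forall x, L2T0 x -> q x = 1 -> q (pK (p (pK x))) <= c ^+ 2) -> a <= c.
Proof.
move=> c0 hc; apply: ge_sup => // _ [f [/L20P[x <- hx] /L2_norm_eq1 qx] <-].
rewrite -[leRHS](ger0_norm c0) -sqrtr_sqr ler_wsqrtr//.
exact: hc.
Qed.

Let contr3 x : q (pK (p (pK x))) <= q (p (pK x)).
Proof. exact: projT_contr. Qed.

Lemma compression_le1 : a <= 1.
Proof.
apply: compression_le => // x hx qx; rewrite expr1n -qx.
by rewrite (le_trans (contr3 x))// (le_trans (projT_contr _ _))// projT_contr.
Qed.

Lemma compression_ge x : L2T0 x -> q x = 1 -> L2_norm pi (pK (p (pK x))) <= a.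
Proof.
move=> hx qx; apply: ub_le_sup; last first.
  by exists x => //; split; [apply/L20P; exists x|apply/L2_norm_eq1].
exists 1 => _ [f [/L20P[y <- hy] /L2_norm_eq1 qy] <-].
rewrite -[leRHS](ger0_norm ler01) -sqrtr_sqr expr1n ler_wsqrtr//.
have : q (pK (p (pK y))) <= q y.
  by rewrite (le_trans (contr3 y))// (le_trans (projT_contr _ _))// projT_contr.
by rewrite [leRHS](_ : _ = 1).
Qed.

Let unique S (hS : L2_closed pi S) x y : q (x - y) = 0 ->
  q (projT hS x - projT hS y) = 0.
Proof.
exact: (@proj_null _ _ _ hE setT (L2_lift pi S) _ (csub_sub (L2_closed_csub hS))
  (fun x _ => projT_in hS x) (fun x _ => projT_orth hS x) x y I I).
Qed.

(** For x in K, |p x|^2 = <p x, x> = <pK p pK x, x>, and Cauchy-Schwarz bounds this by the norm of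
    the compression. *)
Let compression_bound1 x : q x = 1 -> L2T0 x -> K x -> q (p x) <= a.
Proof.
move=> qx hx kx.
have e1 : q (p x) = ip (p x) x.
  exact: (@proj_q _ _ _ hE setT (L2_lift pi W) _ (fun x _ => p_in x)
    (fun x _ => p_orth x)).
have e2 : ip (p x) x = ip (pK (p x)) x.
  by rewrite (@proj_ip _ _ _ hE setT (L2_lift pi K) _ (fun x _ => projT_orth hK x)).
have e3 : q (pK x - x) = 0.
  exact: (@proj_id _ _ _ hE setT (L2_lift pi K) _ (csub_sub (L2_closed_csub hK))
    (fun x _ => projT_in hK x) (fun x _ => projT_orth hK x)).
rewrite e1 e2 -(null_eq hE x (unique hK (unique gap_eigenspace_closed e3))).
apply: le_trans (compression_ge hx qx).
rewrite (le_trans (ler_norm _))// -sqrtr_sqr ler_wsqrtr//.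
by apply: (le_trans (cauchy_schwarz hE _ _)); rewrite qx mulr1.
Qed.

Lemma compression_bound x : L2T0 x -> K x -> q (p x) <= a * q x.
Proof.
move=> hx kx; have [qx|qx] := eqVneq (q x) 0.
  by have := projT_contr gap_eigenspace_closed x; rewrite qx mulr0.
have [s s0 hs] := normalize hE qx.
have Ks : K (s *: x) := subspaceZ s (csub_sub (L2_closed_csub hK)) kx.
have := compression_bound1 hs (subspaceZ s sH0 hx) Ks.
rewrite (@proj_qZ _ _ _ hE setT (L2_lift pi W)
  _ _ (csub_sub (L2_closed_csub gap_eigenspace_closed))
  (fun x _ => p_in x) (fun x _ => p_orth x))//.
have s2 : 0 < s ^+ 2 by rewrite exprn_gt0.
have e : s ^+ 2 * q x = 1 by rewrite -hs !(ipE hE) mulrA -expr2.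
by move=> h; rewrite -(ler_pM2l s2) mulrCA e mulr1.
Qed.

(** [angle_lt1] on the mean-zero part of K bounds squared norms, so the resulting bound on the
    operator norm is a square root. *)
Lemma compression_lt1 : trivial_space pi (W `&` K) -> a < 1.
Proof.
move=> triv.
have [||c c1 hc] := angle_lt1 hE (L2T0_closed_subspace pi) (sym_part_sym0 hP)
  (sym_part_compact hP hcpt) lt_gap
  (right_gap_form_le hP) noeig (setI_csub (L2_closed_csub hK)
    (L2T0_closed_subspace pi)) _
  projW_in projW_orth _.
- by move=> x [].
- move=> x [kx hx] /gap_eigenspace_lift wx.
  by apply/(L2_inner_eq0 (L2T_L2 x)); exact: triv.
(* The constant [c] may be negative when K has no nonnull mean-zero vector. *)
pose c' := Num.max c 0.
have c'0 : 0 <= c' by rewrite le_max lexx orbT.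
have c'1 : c' < 1 by rewrite gt_max c1 ltr01.
apply: (@le_lt_trans _ _ (Num.sqrt c')).
  apply: compression_le => [|x hx qx]; first exact: sqrtr_ge0.
  rewrite sqr_sqrtr// (le_trans (contr3 x))//.
  apply: (le_trans (hc _ _)); first by split; [exact: projT_in|exact: hK0].
  have h1 : q (pK x) <= 1 by rewrite -qx projT_contr.
  have h0 := ip_ge0 hE (pK x).
  apply: (@le_trans _ _ (c' * q (pK x))).
    by rewrite ler_wpM2r// le_max lexx.
  by rewrite -[leRHS]mulr1 ler_wpM2l.
by rewrite -[ltRHS]sqrtr1 ltr_sqrt.
Qed.

End Compression.

(** Because s + t = 1, the left side is 1 - (s A + t B) with A and B the two arguments of the
    minimum, and a convex combination is at least the minimum. *)
Lemma interpolation_le (R : realFieldType) (l l2 al be s t : R) :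
  0 <= s -> 0 <= t -> s + t = 1 ->
  1 - l2 + (l2 - l) * (al * s + be * t) <=
  1 - Num.min (al * l + (1 - al) * l2) (be * l + (1 - be) * l2).
Proof.
move=> s0 t0 st; set A := al * l + _; set B := be * l + _.
have hA : Num.min A B <= A by rewrite ge_min lexx.
have hB : Num.min A B <= B by rewrite ge_min lexx orbT.
have := ler_wpM2l s0 hA; have := ler_wpM2l t0 hB.
have -> : s = 1 - t by rewrite -st addrK.
rewrite /A /B; move: (Num.min _ _) => m; lra.
Qed.

(** * The symmetrized kernel *)

Section Symmetrized.
Context (R : realType) (G : topologicalGroupType) d (X : measurableType d).
Context (pi : probability X R) (mu : probability (borel G) R).
Context (act : G -> X -> X) (hact : measurable_action act).
Hypothesis hpi : invariant_measure act pi.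
Hypothesis hmu : forall (g : G) (A : set (borel G)), measurable A ->
  mu [set (g * h)%g | h in A] = mu A.
Context (P : R.-pker X ~> X) (hP : stationary pi P).
Hypothesis hcpt : compact_operator pi (kernel_op P).
Local Notation H := (L2T pi).
Local Notation ipf := (L2_inner pi).
Local Notation ip := (@L2T_inner R d X pi).
Local Notation q x := (ip x x).
Local Notation P_ := (kernel_op P).
Local Notation N := (neg_sym_gen pi P_).
Local Notation sym_part := (sym_part hP).
Local Notation L2T_one := (L2T_one pi).
Local Notation L2T0 := (@L2T0 R d X pi).
Local Notation lam := (right_gap pi P_).
Context (lambda2 : R) (hl2 : next_eigenvalue pi N lam lambda2).
Let hE := L2_semi_hilbert pi.
Let sH0 := csub_sub (L2T0_closed_subspace pi).
Local Notation W := (L2_eigenspace pi N lam).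
Local Notation p := (projT (gap_eigenspace_closed hP)).
Local Notation V := (inv_space act pi).
Local Notation Vp := (L2_orth pi V).
Local Notation U := (U_op act).

Definition avg_invT (x : H) : H := toL2 (L2_avg_inv mu hact hpi (L2T_L2 x)).
Definition U_opT g (x : H) : H := toL2 (L2_U_op hact hpi g (L2T_L2 x)).

Lemma avg_invT_in x : V (avg_invT x).
Proof. exact: (avg_inv_in hact hpi hmu (L2T_L2 x)). Qed.

Lemma avg_invT_orth x : orth ip (L2_lift pi V) (x - avg_invT x).
Proof. by move=> v hv; exact: (avg_inv_orth mu hact hpi (L2T_L2 x) hv). Qed.

(** The average is invariant at every point; what remains is that x and its average still agree a.e.
    after composition with g, which holds because U_g is an isometry. *)
Lemma avg_invT_null_inv_space x : q (x - avg_invT x) = 0 -> V x.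
Proof.
move=> h; split; first exact: L2T_L2.
move=> g /=.
have hUx : q (U_opT g (x - avg_invT x)) = 0.
  by rewrite -[RHS]h; exact: (L2_inner_U_op hact hpi g (L2T_L2 _) (L2T_L2 _)).
have /(L2_inner_eq0 (L2T_L2 _)) h1 := hUx.
have /(L2_inner_eq0 (L2T_L2 _)) h2 := h.
apply: filterS2 h1 h2 => z /= /(_ I) e1 /(_ I) e2 _.
have e1' : x (act g z) - avg_invT x (act g z) = 0 := e1.
have e2' : x z - avg_invT x z = 0 := e2.
have e3 : avg_invT x (act g z) = avg_invT x z.
  have := avg_inv_invariant hact hmu g (L2_measurable (L2T_L2 x)).
  by move/(congr1 (fun f => f z)).
by rewrite /U_op (subr0_eq e1') e3 -(subr0_eq e2').
Qed.

Lemma inv_space_closed : L2_closed pi V.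
Proof.
split; first by move=> f [].
(* An orthogonal complement is closed for free. If x is orthogonal to the complement of V, then x -
   [avg_invT] x is orthogonal both to x and to [avg_invT] x, hence null. *)
have -> : L2_lift pi V = orth ip (orth ip (L2_lift pi V)).
  apply/seteqP; split=> x hx; first by move=> y hy; rewrite (ipC hE); exact: hy.
  apply: avg_invT_null_inv_space; have ho := avg_invT_orth x.
  have h1 := hx _ ho; have h2 := ho _ (avg_invT_in x).
  by rewrite (ipDl hE) (ipNl hE) h1 (ipC hE (avg_invT x)) h2 subr0.
exact: orth_csub hE _.
Qed.

Lemma inv_space_orth_lift : L2_lift pi Vp = orth ip (L2_lift pi V).
Proof.
apply/seteqP; split=> x; first by move=> [_ h] y hy; exact: h.
move=> h; split; first exact: L2T_L2.
by move=> y hy; exact: (h (toL2 (L2_closed_sub inv_space_closed hy))).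
Qed.

Lemma inv_space_orth_closed : L2_closed pi Vp.
Proof. by split; [move=> f []|rewrite inv_space_orth_lift;
  exact: orth_csub hE _]. Qed.

Lemma inv_space_one : V L2T_one.
Proof. by split; [exact: L2T_L2|move=> g; exact: aeW]. Qed.

Lemma proj_inv_space_mean0 x : L2T0 x -> L2T0 (projT inv_space_closed x).
Proof.
move=> /L2T0E hx; apply/L2T0E.
have := @projT_orth _ _ _ _ _ inv_space_closed x _ inv_space_one.
by rewrite (ipDl hE) (ipNl hE) hx sub0r => /eqP; rewrite oppr_eq0 => /eqP.
Qed.

Lemma inv_space_orth_mean0 x : L2_lift pi Vp x -> L2T0 x.
Proof. by rewrite inv_space_orth_lift => h; apply/L2T0E;
  exact: h inv_space_one. Qed.

Lemma U_opT_inner g x (v : H) : V v -> ip (U_opT g x) v = ip x v.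
Proof. by move=> hv; exact: (inv_space_inner hact hpi g (L2T_L2 x) hv). Qed.

(** The constants are left free to serve twice: with the two compression norms, and with s and 1 - s
    when W is a line. *)
Lemma right_gap_sym_ge (al be : R) :
  (forall x, L2T0 x -> V x -> q (p x) <= al * q x) ->
  (forall x, L2T0 x -> Vp x -> q (p x) <= be * q x) ->
  Num.min (al * lam + (1 - al) * lambda2) (be * lam + (1 - be) * lambda2) <=
  right_gap pi (sym_op act mu P_).
Proof.
move=> hal hbe; apply: right_gap_ge.
- by move=> f hf; exact: (L2_sym_op mu hact hpi hP hf).
- have [x hx qx] := unit_exists hP hl2.
  by exists x => //; apply/L20P; exists x.
move=> _ /L20P[x <- hx] qx.
rewrite (L2_inner_sym_op mu hact hpi hP (L2T_L2 x)).
have gap_ge0 : 0 <= lambda2 - lam by rewrite subr_ge0; case: hl2 => /ltW.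
have pyth (a b : H) : ip b a = 0 -> q (a + b) = q a + q b.
  by move=> e; rewrite !(ipE hE) (ipC hE a) e addr0 add0r.
pose v := avg_invT x; pose h := x - v.
have Vv : V v by exact: avg_invT_in.
have Oh : orth ip (L2_lift pi V) h by exact: avg_invT_orth.
have Hh : L2T0 h by apply: inv_space_orth_mean0; rewrite inv_space_orth_lift.
have Hv : L2T0 v.
  have -> : v = x - h by rewrite opprB addrC subrK.
  exact: (subspaceB sH0 hx Hh).
have qvh : q v + q h = 1.
  rewrite -(pyth _ _ (Oh v Vv)); have -> : v + h = x by rewrite addrC subrK.
  exact: qx.
pose c := al * q v + be * q h.
(* The cross term. Its average over g is the inner product of p v with [avg_invT] h, which is null
   because h is orthogonal to V. *)
pose psi (g : borel G) := ipf (p v) (U g^-1%g h).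
have ipsi : mu.-integrable [set: borel G] (EFin \o psi).
  exact: (integrable_avg_inv mu hact hpi (L2T_L2 h) (L2T_L2 (p v))).
have psi0 : \int[mu]_g psi g = 0.
  rewrite -(L2_inner_avg_inv mu hact hpi (L2T_L2 h) (L2T_L2 (p v))).
  have qa : q (avg_invT h) = 0.
    have := avg_invT_orth h (avg_invT_in h); rewrite (ipDl hE) (ipNl hE).
    by rewrite (Oh _ (avg_invT_in h)) sub0r => /eqP; rewrite oppr_eq0 => /eqP.
  by have := null_ip hE (p v) qa; rewrite (ipC hE).
have pointwise g : ipf (U g^-1%g x) (P_ (U g^-1%g x)) <=
    (1 - lambda2) + (lambda2 - lam) * (c + 2 * psi g).
  pose k := U_opT g^-1%g h; pose y := v + k.
  (* An exact identity of functions, since the average v is invariant at every point and not only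
     almost everywhere. *)
  have ey : U g^-1%g x = y :> (X -> R).
    have hinv := avg_inv_invariant hact hmu g^-1%g (L2_measurable (L2T_L2 x)).
    apply/funext => z; have := congr1 (fun f => f z) hinv.
    rewrite /U_op => e.
    have -> : y z = avg_inv mu act x z + (x (act g^-1%g z)
      - avg_inv mu act x (act g^-1%g z)) by [].
    by rewrite e addrC subrK.
  have Vk : L2_lift pi Vp k.
    by rewrite inv_space_orth_lift => z hz; rewrite U_opT_inner//; exact: Oh.
  have Hk := inv_space_orth_mean0 Vk.
  have qk : q k = q h by exact: (L2_inner_U_op hact hpi g^-1%g (L2T_L2 h)
    (L2T_L2 h)).
  have Hy : L2T0 y := subspaceD sH0 Hv Hk.
  have qy : q y = 1.
    have vk : ip k v = 0 by rewrite U_opT_inner//; exact: Oh.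
    by rewrite (pyth _ _ vk) qk.
  rewrite ey -(sym_part_diag hP y).
  apply: (le_trans (form_le_split hP hcpt hl2 Hy)).
  rewrite qy mulr1 lerD2l; apply: ler_wpM2l; first exact: gap_ge0.
  have -> : q (p y) = q (p v) + 2 * ip (p v) k + q (p k).
    exact: (@proj_qD _ _ _ hE setT (L2_lift pi W)
      _ (csub_sub (setT_closed_subspace pi))
      (csub_sub (L2_closed_csub (gap_eigenspace_closed hP)))
      (fun x _ => projT_in (gap_eigenspace_closed hP) x)
        (fun x _ => projT_orth (gap_eigenspace_closed hP) x)).
  have h1 := hal v Hv Vv; have h2 := hbe k Hk Vk; rewrite qk in h2.
  have -> : psi g = ip (p v) k by [].
  by rewrite addrAC lerD2r; exact: lerD.
have ix := integrable_sym_op mu hact hpi hP (L2T_L2 x).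
have ipsi2 : mu.-integrable [set: borel G] (EFin \o (fun g => (lambda2 - lam)
  * (2 * psi g))).
  have i1 := integrableZl measurableT 2 ipsi.
  by have := integrableZl measurableT (lambda2 - lam) i1; apply: eq_integrable.
have icst (r : R) : mu.-integrable [set: borel G] (EFin \o (fun=> r)).
  exact: L2_integrable (L2_cst mu r).
pose r0 := (1 - lambda2) + (lambda2 - lam) * c.
have irhs : mu.-integrable [set: borel G]
    (EFin \o (fun g => r0 + (lambda2 - lam) * (2 * psi g))).
  by have := integrableD measurableT (icst r0) ipsi2; apply: eq_integrable.
have h1 : \int[mu]_g ipf (U g^-1%g x) (P_ (U g^-1%g x)) <=
    \int[mu]_g (r0 + (lambda2 - lam) * (2 * psi g)).
  apply: le_Rintegral => // g _; apply: (le_trans (pointwise g)).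
  by rewrite /r0 mulrDr addrA.
apply: (le_trans h1); rewrite RintegralD//.
have -> : \int[mu]_g ((lambda2 - lam) * (2 * psi g)) = 0.
  have -> : \int[mu]_g ((lambda2 - lam) * (2 * psi g))
    = \int[mu]_g ((lambda2 - lam) * 2 * psi g).
    by apply: eq_Rintegral => g _; rewrite mulrA.
  by rewrite RintegralZl// psi0 mulr0.
rewrite Rintegral_cst_probability addr0 /r0 /c.
exact: interpolation_le (ip_ge0 hE v) (ip_ge0 hE h) qvh.
Qed.

End Symmetrized.

(** * The case of a one-dimensional eigenspace *)

Section OneDimensional.
Context (R : realType) (G : topologicalGroupType) d (X : measurableType d).
Context (pi : probability X R) (mu : probability (borel G) R).
Context (act : G -> X -> X) (hact : measurable_action act).
Hypothesis hpi : invariant_measure act pi.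
Hypothesis hmu : forall (g : G) (A : set (borel G)), measurable A ->
  mu [set (g * h)%g | h in A] = mu A.
Context (P : R.-pker X ~> X) (hP : stationary pi P).
Local Notation H := (L2T pi).
Local Notation ipf := (L2_inner pi).
Local Notation ip := (@L2T_inner R d X pi).
Local Notation q x := (ip x x).
Local Notation W := (L2_eigenspace pi (neg_sym_gen pi (kernel_op P))
  (right_gap pi (kernel_op P))).
Local Notation p := (projT (gap_eigenspace_closed hP)).
Local Notation V := (inv_space act pi).
Local Notation Vp := (L2_orth pi V).
Local Notation avg_invT := (avg_invT mu hact hpi).
Let hE := L2_semi_hilbert pi.
Context (u : H) (Wu : W u) (qu : q u = 1).
Hypothesis span_u : forall f, W f -> exists c : R, f = (fun x => c * u x) %[ae pi].

Lemma projW_line x : q (p x) = ip x u ^+ 2.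
Proof.
have [c hc] := span_u (projT_in (gap_eigenspace_closed hP) x).
have e : q (p x - c *: u) = 0 by apply/ae_null; exact: hc.
have -> : ip x u = c.
  rewrite -(@proj_ip _ _ _ hE setT (L2_lift pi W) _
    (fun x _ => projT_orth (gap_eigenspace_closed hP) x) x u I Wu).
  by rewrite (null_eq hE _ e) (ipZl hE) qu mulr1.
by rewrite (null_q hE e) (ipZl hE) (ipZr hE) qu mulr1 expr2.
Qed.

Lemma avg_invT_split : q u = q (avg_invT u) + q (u - avg_invT u).
Proof.
exact: (@pythagoras _ _ _ hE setT (L2_lift pi V)
  _ (fun x _ => avg_invT_in hact hpi hmu x)
  (fun x _ => avg_invT_orth mu hact hpi x) u I).
Qed.

(** The averages over U_g and over its inverse are compared only through inner products, so
    [avg_avg_inv] is used once in each argument. *)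
Lemma avg_norm_sqr : L2_norm pi (avg act mu u) ^+ 2 = q (avg_invT u).
Proof.
have hu := L2T_L2 u; have ha := L2_avg mu hact hpi hu;
  have hv := L2_avg_inv mu hact hpi hu.
rewrite L2_norm_sqr (avg_avg_inv hact hpi hmu hu ha) L2_innerC.
exact: (avg_avg_inv hact hpi hmu hu hv).
Qed.

(** For x in V the coefficient <x, u> equals <x, u_V>, and Cauchy-Schwarz applies to the latter. *)
Lemma projW_V (x : H) : V x -> q (p x) <= q (avg_invT u) * q x.
Proof.
move=> hx; rewrite projW_line mulrC.
have := avg_invT_orth mu hact hpi u hx.
rewrite (ipDl hE) (ipNl hE) => /subr0_eq; rewrite (ipC hE) => ->.
by rewrite (ipC hE); exact: cauchy_schwarz.
Qed.

(** For x orthogonal to V the coefficient is <x, u - u_V>, and by Pythagoras |u - u_V|^2 = 1 -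
    |u_V|^2. *)
Lemma projW_Vp (x : H) : Vp x -> q (p x) <= (1 - q (avg_invT u)) * q x.
Proof.
move=> [_ hx]; have h := hx _ (avg_invT_in hact hpi hmu u).
have -> : 1 - q (avg_invT u) = q (u - avg_invT u).
  by apply/eqP; rewrite subr_eq addrC -avg_invT_split; apply/eqP/esym.
rewrite projW_line mulrC.
have -> : ip x u = ip x (u - avg_invT u).
  rewrite (ipDr hE u) (ipNr hE (avg_invT u)).
  have -> : ip x (avg_invT u) = 0 by exact: h.
  by rewrite subr0.
exact: cauchy_schwarz.
Qed.

End OneDimensional.

Lemma interpolation_ge (R : realFieldType) (l l2 al be : R) :
  l < l2 -> al <= 1 -> be <= 1 ->
  l <= Num.min (al * l + (1 - al) * l2) (be * l + (1 - be) * l2).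
Proof. by move=> ll a1 b1; rewrite le_min; apply/andP; split; nra. Qed.

Lemma interpolation_gt (R : realFieldType) (l l2 al be : R) :
  l < l2 -> al < 1 -> be < 1 ->
  l < Num.min (al * l + (1 - al) * l2) (be * l + (1 - be) * l2).
Proof. by move=> ll a1 b1; rewrite lt_min; apply/andP; split; nra. Qed.

Theorem theorem3p1 (R : realType)
    (X : completePseudoMetricType R) (hX : polish X)
    (pi : probability (borel X) R)
    (G : topologicalGroupType) (hG : locally_compact [set: G])
    (mu : probability (borel G) R) (hmu : haar_measure mu)
    (act : G -> borel X -> borel X) (hact : measurable_action act)
    (m : {measure set (borel X) -> \bar R})
    (hm : invariant_measure act m) (hdens : has_density pi m)
    (hpi : invariant_measure act pi)
    (P : R.-pker (borel X) ~> (borel X)) (hP : stationary pi P)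
    (hcpt : compact_operator pi (kernel_op P))
    (lambda2 : R)
    (hlambda2 : next_eigenvalue pi (neg_sym_gen pi (kernel_op P))
                  (right_gap pi (kernel_op P)) lambda2) :
  let lambda := right_gap pi (kernel_op P) in
  let lambdabar := right_gap pi (sym_op act mu (kernel_op P)) in
  let W := L2_eigenspace pi (neg_sym_gen pi (kernel_op P)) lambda in
  let V := inv_space act pi in
  let Vp := L2_orth pi V in
  let a := L20_opnorm pi (L2_proj pi V \o L2_proj pi W \o L2_proj pi V) in
  let b := L20_opnorm pi (L2_proj pi Vp \o L2_proj pi W \o L2_proj pi Vp) in
  let bound := Num.min (a * lambda + (1 - a) * lambda2)
                       (b * lambda + (1 - b) * lambda2) in
  [/\ lambdabar >= bound, bound >= lambda,
      trivial_space pi (W `&` V) -> trivial_space pi (W `&` Vp) ->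
        lambdabar > lambda
    & forall u : X -> R,
        W u -> L2_norm pi u = 1 ->
        (forall f, W f -> exists c : R, f = (fun x => c * u x) %[ae pi]) ->
        let uV := avg act mu u in
        let s := L2_norm pi uV ^+ 2 in
        let bound1 := Num.min (s * lambda + (1 - s) * lambda2)
                              ((1 - s) * lambda + s * lambda2) in
        [/\ lambdabar >= bound1, bound1 >= lambda
          & ~ (forall g, U_op act g u = u %[ae pi]) -> ~ (uV = cst 0 %[ae pi]) ->
            lambdabar > lambda]].
Proof.
have hleft : forall (g : G) (A : set (borel G)), measurable A ->
    mu [set (g * h)%g | h in A] = mu A by exact: haar_left_invariant hmu.
move=> lambda lambdabar W V Vp a b bound.
have ll : lambda < lambda2 by case: hlambda2.
have hV := inv_space_closed hact hpi hleft;
  have hVp := inv_space_orth_closed hact hpi hleft.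
have hV0 := proj_inv_space_mean0 hact hpi hleft.
have hVp0 x : L2T0 x -> L2T0 (projT hVp x).
  by move=> _; apply: (inv_space_orth_mean0 hact hpi hleft); exact: projT_in.
have main := right_gap_sym_ge hact hpi hleft (hP := hP) hcpt hlambda2.
have h1 : bound <= lambdabar.
  apply: main => x hx kx.
    exact: (compression_bound hP hV).
  exact: (compression_bound hP hVp).
have a1 : a <= 1 := compression_le1 hP hlambda2 hV.
have b1 : b <= 1 := compression_le1 hP hlambda2 hVp.
split; [exact: h1|exact: (interpolation_ge ll a1 b1)| |].
  move=> tV tVp; apply: lt_le_trans h1; apply: (interpolation_gt ll).
    exact: (compression_lt1 hP hcpt hlambda2 hV0 tV).
  exact: (compression_lt1 hP hcpt hlambda2 hVp0 tVp).
move=> u Wu /L2_norm_eq1 qu span uV s bound1.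
have hu : L2 pi u by case: Wu.
pose x := toL2 hu.
have sE : s = L2T_inner (avg_invT mu hact hpi x) (avg_invT mu hact hpi x) :=
  avg_norm_sqr hact hpi hleft x.
have split1 := avg_invT_split hact hpi hleft x.
have qx : L2T_inner x x = 1 by exact: qu.
rewrite qx -sE in split1.
have hE := L2_semi_hilbert pi.
have r0 := ip_ge0 hE (x - avg_invT mu hact hpi x).
have s0 : 0 <= s by rewrite sE; exact: ip_ge0 hE _.
have s1 : s <= 1 by rewrite split1 lerDl.
(* Rewriting s as 1 - (1 - s) exhibits the second argument as the interpolation with weight 1 -
   s. *)
have E1 : bound1 = Num.min (s * lambda + (1 - s) * lambda2)
    ((1 - s) * lambda + (1 - (1 - s)) * lambda2) by rewrite /bound1 subKr.
have h2 : bound1 <= lambdabar.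
  rewrite E1; apply: main => y hy ky; rewrite sE.
    exact: (projW_V mu hact hpi hP (u := x) Wu qx span ky).
  exact: (projW_Vp hact hpi hleft hP (u := x) Wu qx span ky).
split; [exact: h2| |].
  by rewrite E1; apply: (interpolation_ge ll s1); rewrite gerBl.
move=> ninv n0; apply: lt_le_trans h2; rewrite E1; apply: (interpolation_gt ll).
  (* If s = 1, Pythagoras makes u minus its average null, so u is invariant. *)
  rewrite lt_neqAle s1 andbT; apply/eqP => e; apply: ninv.
  have q0 : L2T_inner (x - avg_invT mu hact hpi x) (x - avg_invT mu hact hpi x) = 0.
    by apply: (addrI s); rewrite addr0 -split1 e.
  exact: (avg_invT_null_inv_space hleft q0).2.
(* The weight 1 - s is below 1 exactly when s > 0, and s = 0 would make u_V vanish almost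
   everywhere. *)
rewrite gtrBl lt_neqAle s0 andbT; apply/eqP => e; apply: n0.
have ha : L2 pi uV by exact: L2_avg.
by apply/(L2_inner_eq0 ha); rewrite -L2_norm_sqr; exact/esym.
Qed.
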